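(* For any fixed integer $K \geq 1$, the following problem can be solved in polynomial time: given $K$ permutations $\sigma^1, \ldots, \sigma^K$ (of arbitrary lengths, with no restriction on them), compute a separable permutation $\pi$ of maximal length such that $\pi$ is a pattern of every $\sigma^q$, $1 \leq q \leq K$.
   Context: A permutation of length $n$ is a bijection of $[1..n]$, written as a word $\sigma_1\sigma_2\cdots\sigma_n$. A permutation $\pi$ of length $k$ is a pattern of (is involved in) a permutation $\sigma$ of length $n$ if there are indices $1 \le i_1 < \cdots < i_k \le n$ such that $\sigma_{i_\ell} < \sigma_{i_m}$ whenever $\pi_\ell < \pi_m$. A permutation is separable if it involves neither $2413$ nor $3142$ as a pattern. The empty permutation is considered separable and a pattern of every permutation. *)

(* Defs.v *)
From mathcomp Require Import all_boot all_fingroup.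

Set Implicit Arguments.
Unset Strict Implicit.
Unset Printing Implicit Defensive.

(* Permutations of arbitrary (possibly zero) length. The positions and values
   1..n are the elements 0..n-1 of 'I_n; only [word] is 1-based. *)
Definition permutation : Type := {n : nat & 'S_n}.

Definition plength (s : permutation) : nat := tag s.

Definition word (s : permutation) : seq nat :=
  [seq (tagged s i).+1 | i <- enum 'I_(plength s)].

Definition pattern (p s : permutation) : Prop :=
  exists f : 'I_(plength p) -> 'I_(plength s),
    {homo f : l m / l < m} /\
    forall l m, tagged p l < tagged p m -> tagged s (f l) < tagged s (f m).

Lemma inj_2413 :
  injective (tnth [tuple @inord 3 1; @inord 3 3; @inord 3 0; @inord 3 2]).
Proof. by apply/tuple_uniqP; rewrite -(map_inj_uniq val_inj) /= !inordK. Qed.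

Lemma inj_3142 :
  injective (tnth [tuple @inord 3 2; @inord 3 0; @inord 3 3; @inord 3 1]).
Proof. by apply/tuple_uniqP; rewrite -(map_inj_uniq val_inj) /= !inordK. Qed.

Definition p2413 : permutation := existT _ 4 (perm inj_2413).
Definition p3142 : permutation := existT _ 4 (perm inj_3142).

Lemma word_2413 : word p2413 = [:: 2; 4; 1; 3].
Proof.
by rewrite /word /= !enum_ordSl enum_ord0 /= !permE /= !(tnth_nth ord0) /= !inordK.
Qed.

Lemma word_3142 : word p3142 = [:: 3; 1; 4; 2].
Proof.
by rewrite /word /= !enum_ordSl enum_ord0 /= !permE /= !(tnth_nth ord0) /= !inordK.
Qed.

Definition separable (s : permutation) : Prop :=
  ~ pattern p2413 s /\ ~ pattern p3142 s.

Definition common_separable (K : nat) (sigma : K.-tuple permutation)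
    (p : permutation) : Prop :=
  separable p /\ forall q : 'I_K, pattern p (tnth sigma q).

Definition longest_common_separable (K : nat) (sigma : K.-tuple permutation)
    (p : permutation) : Prop :=
  common_separable sigma p /\
  forall p', common_separable sigma p' -> plength p' <= plength p.

(* Running time is measured on the random access machine of Cook and Reckhow
   (1973), with unit cost. Addition and subtraction are the only arithmetic
   operations, so polynomial time here is polynomial time on Turing machines.
   The registers X 0, X 1, ... hold naturals and subtraction is truncated;
   reading past the end of the input yields 0. *)
Inductive instr : Type :=
| Const of nat & nat
| Add of nat & nat & nat
| Sub of nat & nat & nat
| Fetch of nat & nat
| Store of nat & nat
| JumpPos of nat & nat
| Read of nat
| Print of nat.

Definition program : Type := seq instr.

Record config : Type := Config {
  pc : nat;
  regs : nat -> nat;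
  input : seq nat;
  output : seq nat }.

Definition init (x : seq nat) : config := Config 0 (fun=> 0) x [::].

Definition upd (X : nat -> nat) (i v : nat) : nat -> nat :=
  fun j => if j == i then v else X j.

Definition exec (a : instr) (c : config) : config :=
  let: Config l X x o := c in
  match a with
  | Const i v => Config l.+1 (upd X i v) x o
  | Add i j k => Config l.+1 (upd X i (X j + X k)) x o
  | Sub i j k => Config l.+1 (upd X i (X j - X k)) x o
  | Fetch i j => Config l.+1 (upd X i (X (X j))) x o
  | Store i j => Config l.+1 (upd X (X i) (X j)) x o
  | JumpPos m j => Config (if 0 < X j then m else l.+1) X x o
  | Read i => Config l.+1 (upd X i (head 0 x)) (behead x) o
  | Print i => Config l.+1 X x (rcons o (X i))
  end.

(* [None] means that the machine has halted: [pc c] is not the address of an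
   instruction. *)
Definition step (P : program) (c : config) : option config :=
  omap (exec^~ c) (onth P (pc c)).

Fixpoint run (P : program) (t : nat) (c : config) : option config :=
  if t is t'.+1 then obind (run P t') (step P c) else Some c.

Definition halts_in (P : program) (x : seq nat) (t : nat) (y : seq nat) : Prop :=
  exists c, [/\ run P t (init x) = Some c, step P c = None & output c = y].

(* A search problem: instances are presented by [enc], and [sol x y] says that
   y is a correct answer for x. The bound is in the number of input numbers;
   when their values are polynomial in their number, as for [encode], this is
   the same as a polynomial bound in the number of input bits. *)
Definition poly_time_solvable (I : Type) (enc : I -> seq nat)
    (sol : I -> seq nat -> Prop) : Prop :=
  exists (P : program) (a d : nat), forall x : I, exists (t : nat) (y : seq nat),
    [/\ halts_in P (enc x) t y, t <= a * size (enc x) ^ d + a & sol x y].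

Definition encode (K : nat) (sigma : K.-tuple permutation) : seq nat :=
  flatten [seq plength s :: word s | s <- sigma].

(* Main.v *)
(* A permutation of length at least 2 avoiding 2413 and 3142 is a direct or a skew
   sum of two shorter ones. Hence the longest common separable pattern inside a
   box (for every q, an interval of positions and one of values of sigma^q)
   either is a single point or splits along a point of the box. There are
   polynomially many boxes, since K is fixed, and repeating the update
   T[box] := max(T[box], T[box1] + T[box2]) over all boxes and splits as often as
   the longest pattern has elements yields all optimal lengths. To get a pattern
   and not only its length, delete the elements of one of the permutations one
   by one, restoring those whose deletion decreases the optimum: what is left is
   an occurrence of an optimal pattern.
   This is programmed in a language of bounded loops with arrays, whose programs
   run in polynomial time for syntactic reasons, and compiled to the machine. *)
Require Import Defs.
From mathcomp Require Import all_boot all_fingroup.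
From mathcomp Require Import zify.

Set Implicit Arguments.
Unset Strict Implicit.
Unset Printing Implicit Defensive.


(** * Bounded loop programs and their compilation *)

(** One number carries the running time: [vN], the total length of the words plus 2. It bounds every
    loop after the input phase and is the base in which table indices are written. As nothing
    changes it after that phase, the cost bound is a matter of syntax. The machine cannot multiply,
    so the index arithmetic itself is compiled to loops and paid for in the same currency. Deleting
    an element overwrites it with 0, a value that no word contains. Thus positions and values are
    never renumbered, boxes keep their meaning, and only the printed word is standardized. Boxes
    need not be processed by size. Every update is sound, as each table entry remains the length of
    some pattern inside its box, and no update decreases an entry. Hence a pass only has to bring
    each box together with each split at some moment, in whatever order, and the optimum follows
    from soundness and completeness, proved separately. *)

Fixpoint loop {A : Type} (f : nat -> A -> A) (n : nat) (a : A) : A :=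
  if n is k.+1 then loop f k (f k a) else a.

Lemma loop_ind {A : Type} (f : nat -> A -> A) (I : nat -> A -> Prop) n a :
  I n a -> (forall k a, k < n -> I k.+1 a -> I k (f k a)) -> I 0 (loop f n a).
Proof.
elim: n a => //= n IHn a Ia If; apply: IHn => [|k b ltkn]; first exact: If.
by apply: If; rewrite ltnS ltnW.
Qed.

Section Language.

Variables (V : countType) (Q : finType).

(** The second factor of [Scale] is a variable, so that a product, computed by repeated addition,
    can be charged to that variable in the same way as a loop. *)
Inductive expr :=
| Cst of nat
| Var of V
| Plus of expr & expr
| Minus of expr & expr
| Scale of expr & V
| Get of Q & expr.

Inductive stmt :=
| Skip
| Assign of V & expr
| Put of Q & expr & expr
| Seq of stmt & stmt
| If of expr & stmt
| For of V & V & stmt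
| In of V
| Out of expr.

Record state := State {
  var : V -> nat;
  arr : Q -> nat -> nat;
  inp : seq nat;
  out : seq nat }.

Fixpoint eval (st : state) (e : expr) : nat :=
  match e with
  | Cst n => n
  | Var x => var st x
  | Plus e1 e2 => eval st e1 + eval st e2
  | Minus e1 e2 => eval st e1 - eval st e2
  | Scale e x => eval st e * var st x
  | Get q e => arr st q (eval st e)
  end.

Definition setv (st : state) (x : V) (v : nat) : state :=
  State (fun y => if y == x then v else var st y) (arr st) (inp st) (out st).

Definition seta (st : state) (q : Q) (i v : nat) : state :=
  State (var st)
    (fun q' j => if (q' == q) && (j == i) then v else arr st q' j)
    (inp st) (out st).

(* The loop variable of [For x n s] runs downwards from [n - 1] to [0]. *)
Fixpoint sem (s : stmt) (st : state) : state :=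
  match s with
  | Skip => st
  | Assign x e => setv st x (eval st e)
  | Put q i e => seta st q (eval st i) (eval st e)
  | Seq s1 s2 => sem s2 (sem s1 st)
  | If e s1 => if 0 < eval st e then sem s1 st else st
  | For x n s1 => loop (fun k st' => sem s1 (setv st' x k)) (var st n) st
  | In x => State (var (setv st x (head 0 (inp st)))) (arr st)
              (behead (inp st)) (out st)
  | Out e => State (var st) (arr st) (inp st) (rcons (out st) (eval st e))
  end.

(* The registers are split into residue classes modulo [width]: variables,
   temporaries, and one class for each array. *)
Definition width := #|Q|.+2.
Definition vaddr (x : V) := pickle x * width.
Definition tmp (d : nat) := d * width + 1.
Definition aaddr (q : Q) (i : nat) := i * width + (enum_rank q).+2.

(** Repeated addition of [tmp d] into [tmp d.+2], counted down in [tmp d.+1]. The loop is entered at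
    its test, [l + 5], which takes care of a zero factor. Adding a register set to zero serves as a
    move instruction. *)
Definition mul_code (d l : nat) : program :=
  [:: Const (tmp d.+2) 0; Const (tmp d.+3) 1; JumpPos (l + 5) (tmp d.+3);
      Add (tmp d.+2) (tmp d.+2) (tmp d); Defs.Sub (tmp d.+1) (tmp d.+1) (tmp d.+3);
      JumpPos (l + 3) (tmp d.+1);
      Const (tmp d.+1) 0; Add (tmp d) (tmp d.+2) (tmp d.+1)].

Definition addr_code (q : Q) (d l : nat) : program :=
  [:: Const (tmp d.+1) width] ++ mul_code d l.+1 ++
  [:: Const (tmp d.+1) (enum_rank q).+2; Add (tmp d) (tmp d) (tmp d.+1)].

(** Jump targets are absolute, so a piece of code is a function of its load address. *)
Definition seq_code (c1 c2 : nat -> program) (l : nat) : program :=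
  let c := c1 l in c ++ c2 (l + size c).

Definition var_code (x : V) (d l : nat) : program :=
  [:: Const (tmp d) 0; Add (tmp d) (vaddr x) (tmp d)].

Fixpoint expr_code (e : expr) (d l : nat) : program :=
  match e with
  | Cst n => [:: Const (tmp d) n]
  | Var x => var_code x d l
  | Plus e1 e2 => seq_code (seq_code (expr_code e1 d) (expr_code e2 d.+1))
      (fun=> [:: Add (tmp d) (tmp d) (tmp d.+1)]) l
  | Minus e1 e2 => seq_code (seq_code (expr_code e1 d) (expr_code e2 d.+1))
      (fun=> [:: Defs.Sub (tmp d) (tmp d) (tmp d.+1)]) l
  | Scale e x => seq_code
      (seq_code (expr_code e d) (var_code x d.+1)) (mul_code d) l
  | Get q e => seq_code (seq_code (expr_code e d) (addr_code q d))
      (fun=> [:: Fetch (tmp d) (tmp d)]) l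
  end.

(** The counter of a loop lives in [tmp d] and its body is compiled at depth [d.+1]. The loop
    variable is only a copy of the counter, so assigning to it in the body does not disturb the
    iteration, in agreement with [sem]. *)
Fixpoint stmt_code (s : stmt) (d l : nat) : program :=
  match s with
  | Skip => [::]
  | Assign x e => seq_code (expr_code e d)
      (fun=> [:: Const (tmp d.+1) 0; Add (vaddr x) (tmp d) (tmp d.+1)]) l
  | Put q i e => seq_code (seq_code (seq_code (expr_code i d) (addr_code q d))
      (expr_code e d.+1)) (fun=> [:: Store (tmp d) (tmp d.+1)]) l
  | Seq s1 s2 => seq_code (stmt_code s1 d) (stmt_code s2 d) l
  | If e s1 => seq_code (expr_code e d) (fun l =>
      let c := stmt_code s1 d (l + 3) in
      [:: JumpPos (l + 3) (tmp d); Const (tmp d) 1;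
          JumpPos (l + 3 + size c) (tmp d)] ++ c) l
  | For x n s1 => seq_code (var_code n d) (fun l =>
      let c := stmt_code s1 d.+1 (l + 6) in
      [:: Const (tmp d.+1) 1; JumpPos (l + 6 + size c) (tmp d.+1);
          Const (tmp d.+1) 1; Defs.Sub (tmp d) (tmp d) (tmp d.+1);
          Const (tmp d.+1) 0; Add (vaddr x) (tmp d) (tmp d.+1)] ++ c ++
      [:: JumpPos (l + 2) (tmp d)]) l
  | In x => [:: Read (vaddr x)]
  | Out e => seq_code (expr_code e d) (fun=> [:: Print (tmp d)]) l
  end.

(** * Cost bounds and the simulation relation *)

Fixpoint expr_cost (st : state) (e : expr) : nat :=
  match e with
  | Cst n => 1
  | Var x => 2
  | Plus e1 e2 | Minus e1 e2 => expr_cost st e1 + expr_cost st e2 + 1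
  | Scale e x => expr_cost st e + (8 + 3 * var st x)
  | Get q e => expr_cost st e + (10 + 3 * width)
  end.

(** Only an upper bound: [If] pays for its body even when the test fails. The pair in the loop
    carries the state along, since the cost of an iteration depends on it. *)
Fixpoint stmt_cost (s : stmt) (st : state) : nat :=
  match s with
  | Skip => 0
  | Assign x e => expr_cost st e + 2
  | Put q i e => expr_cost st i + expr_cost st e + (10 + 3 * width)
  | Seq s1 s2 => stmt_cost s1 st + stmt_cost s2 (sem s1 st)
  | If e s1 => expr_cost st e + (3 + stmt_cost s1 st)
  | For x n s1 =>
      5 + (loop (fun k st' => (sem s1 (setv st'.1 x k),
                               st'.2 + (stmt_cost s1 (setv st'.1 x k) + 5)))
                (var st n) (st, 0)).2
  | In x => 1
  | Out e => expr_cost st e + 1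
  end.

Definition sim (X : nat -> nat) (st : state) :=
  (forall x, X (vaddr x) = var st x) /\
  (forall q i, X (aaddr q i) = arr st q i).

(** Temporaries of depth below [d] hold pending operands and the counters of enclosing loops, which
    evaluation at depth [d] must not touch. *)
Definition frame (d : nat) (X Y : nat -> nat) :=
  forall j, (forall k, d <= k -> j <> tmp k) -> Y j = X j.

Lemma frame_trans d d' X Y Z :
  d <= d' -> frame d X Y -> frame d' Y Z -> frame d X Z.
Proof.
move=> ledd' XY YZ j jd; rewrite YZ ?XY// => k led'k.
exact/jd/(leq_trans ledd').
Qed.

Lemma frame_upd d k X v : d <= k -> frame d X (upd X (tmp k) v).
Proof. by move=> ledk j jd; rewrite /upd; case: eqP => // /jd -/(_ ledk). Qed.

Lemma tmp_inj : injective tmp.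
Proof. by move=> d d' /eqP; rewrite eqn_add2r eqn_pmul2r// => /eqP. Qed.

Lemma tmp_eq d d' : (tmp d == tmp d') = (d == d').
Proof. by rewrite (inj_eq tmp_inj). Qed.

Lemma mod_addr i r : r < width -> (i * width + r) %% width = r.
Proof. by move=> r_lt; rewrite modnMDl modn_small. Qed.

Lemma vaddr_tmp x d : vaddr x <> tmp d.
Proof.
move=> /(congr1 (modn^~ width)); rewrite /tmp mod_addr//.
by rewrite /vaddr -[_ * _]addn0 mod_addr.
Qed.

Lemma aaddr_lt (q : Q) : (enum_rank q).+2 < width.
Proof. by rewrite !ltnS. Qed.

Lemma aaddr_tmp q i d : aaddr q i <> tmp d.
Proof.
by move=> /(congr1 (modn^~ width)); rewrite /tmp !mod_addr ?aaddr_lt.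
Qed.

Lemma vaddr_aaddr x q i : vaddr x <> aaddr q i.
Proof.
move=> /(congr1 (modn^~ width)); rewrite mod_addr ?aaddr_lt//.
by rewrite /vaddr -[_ * _]addn0 mod_addr.
Qed.

Lemma vaddr_inj : injective vaddr.
Proof.
move=> x y /eqP; rewrite eqn_pmul2r// => /eqP.
exact: (pcan_inj pickleK).
Qed.

Lemma aaddr_inj q i q' i' : aaddr q i = aaddr q' i' -> q = q' /\ i = i'.
Proof.
move=> e; have /(congr1 (modn^~ width)) := e.
rewrite !mod_addr ?aaddr_lt// => -[/ord_inj/enum_rank_inj eq_q].
by split=> //; move: e; rewrite eq_q => /eqP; rewrite eqn_add2r eqn_pmul2r// => /eqP.
Qed.

Lemma frame_tmp d k X Y : k < d -> frame d X Y -> Y (tmp k) = X (tmp k).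
Proof. by move=> ltkd XY; apply: XY => k' ledk' /tmp_inj; lia. Qed.

Lemma frame_sim d X Y st : frame d X Y -> sim X st -> sim Y st.
Proof.
move=> XY [simv sima]; split=> [x|q i].
- by rewrite XY ?simv// => k _; exact: vaddr_tmp.
- by rewrite XY ?sima// => k _; exact: aaddr_tmp.
Qed.

(** * Execution of the compiled code *)

Fixpoint code_at (P : program) (l : nat) (c : program) : Prop :=
  if c is a :: c' then onth P l = Some a /\ code_at P l.+1 c' else True.

Lemma code_at_cat P l c c' :
  code_at P l (c ++ c') <-> code_at P l c /\ code_at P (l + size c) c'.
Proof.
elim: c l => [|a c IHc] l /=; first by rewrite addn0; tauto.
by rewrite IHc addnS -addSn; tauto.
Qed.

Lemma code_at_self (P P' : program) : code_at (P' ++ P) (size P') P.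
Proof.
elim: P P' => //= a P IHP P'; split; first by rewrite onth_cat ltnn subnn.
by rewrite -cat_rcons -(size_rcons P' a); exact: IHP.
Qed.

Lemma run_add P t t' c : run P (t + t') c = obind (run P t') (run P t c).
Proof.
elim: t c => //= t IHt c; case: (step P c) => //= c'; exact: IHt.
Qed.

Lemma run1 P a l X x o : onth P l = Some a ->
  forall t, run P t.+1 (Config l X x o) = run P t (exec a (Config l X x o)).
Proof. by move=> Pl t; rewrite /= /step /= Pl. Qed.

Definition reach (P : program) (T : nat) (c c' : config) :=
  exists2 t, t <= T & run P t c = Some c'.

Lemma reach0 P T c : reach P T c c.
Proof. by exists 0. Qed.

Lemma reach_step P a l X x o T c : onth P l = Some a ->
  reach P T (exec a (Config l X x o)) c -> reach P T.+1 (Config l X x o) c.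
Proof. by move=> Pl [t leT r]; exists t.+1; rewrite ?(run1 _ _ _ Pl). Qed.

Lemma reach_trans P T T' c c' c'' :
  reach P T c c' -> reach P T' c' c'' -> reach P (T + T') c c''.
Proof.
move=> [t tT r] [t' tT' r']; exists (t + t'); first exact: leq_add.
by rewrite run_add r.
Qed.

Lemma reach_le P T T' c c' : T <= T' -> reach P T c c' -> reach P T' c c'.
Proof. by move=> leT [t tT r]; exists t; first exact: leq_trans leT. Qed.

Lemma reach_pc P T c l l' X x o : l = l' ->
  reach P T c (Config l X x o) -> reach P T c (Config l' X x o).
Proof. by move=> ->. Qed.

Lemma mul_loop P d l X x o : code_at P l (mul_code d l) -> X (tmp d.+3) = 1 ->
  exists2 X', reach P (1 + 3 * X (tmp d.+1))
      (Config (l + 5) X x o) (Config (l + 6) X' x o)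
    & X' (tmp d.+2) = X (tmp d.+2) + X (tmp d) * X (tmp d.+1) /\
      X' (tmp d) = X (tmp d) /\ frame d X X'.
Proof.
move=> [_ [_ [_ [c3 [c4 [c5 _]]]]]].
move: {2}(X _) (erefl (X (tmp d.+1))) => b; elim: b X => [|b IHb] X Xb X3.
  exists X; last by rewrite Xb muln0 addn0.
  apply: reach_step; first by rewrite addnC; exact: c5.
  by rewrite /= Xb !addnS; exact: reach0.
set X1 := upd X (tmp d.+2) (X (tmp d.+2) + X (tmp d)).
set X2 := upd X1 (tmp d.+1) (X1 (tmp d.+1) - X1 (tmp d.+3)).
have X2d k : k != d.+1 -> k != d.+2 -> X2 (tmp k) = X (tmp k).
  by rewrite /X2 /X1 /upd !tmp_eq => /negbTE-> /negbTE->.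
have X2b : X2 (tmp d.+1) = b.
  have ne1 : (d.+1 == d.+2) = false by lia.
  have ne2 : (d.+3 == d.+2) = false by lia.
  by rewrite /X2 /X1 /upd !tmp_eq eqxx ne1 ne2 Xb X3 subn1.
have X2c : X2 (tmp d.+2) = X (tmp d.+2) + X (tmp d).
  have ne1 : (d.+2 == d.+1) = false by lia.
  by rewrite /X2 /X1 /upd !tmp_eq eqxx ne1.
have [] := IHb X2 X2b; first by rewrite X2d ?X3; lia.
move=> X' r [X'c [X'd X'f]]; exists X'.
  rewrite Xb (_ : 1 + _ = (1 + 3 * b).+3); last by lia.
  apply: reach_step; first by rewrite addnC; exact: c5.
  rewrite /= Xb /=.
  apply: reach_step; first by rewrite addnC; exact: c3.
  apply: reach_step; first by rewrite /= addnC; exact: c4.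
  by rewrite X2b in r; move: r; rewrite /= -/X1 -/X2 !addnS.
rewrite X'c X'd X2c (X2d d); [|lia..].
split; first by rewrite X2b Xb; nia.
split=> //; apply: frame_trans X'f => //.
apply: (@frame_trans _ d _ X1) => //; apply: frame_upd; lia.
Qed.

Lemma mul_code_ok P d l X x o : code_at P l (mul_code d l) ->
  exists2 X', reach P (6 + 3 * X (tmp d.+1))
      (Config l X x o) (Config (l + 8) X' x o)
    & X' (tmp d) = X (tmp d) * X (tmp d.+1) /\ frame d X X'.
Proof.
move=> c; have [c0 [c1 [c2 [_ [_ [_ [c6 [c7 _]]]]]]]] := c.
set X1 := upd (upd X (tmp d.+2) 0) (tmp d.+3) 1.
have X1d k : k < d.+2 -> X1 (tmp k) = X (tmp k).
  move=> ltk; rewrite /X1 /upd !tmp_eq.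
  have -> : (k == d.+3) = false by lia.
  by have -> : (k == d.+2) = false by lia.
have X1c : X1 (tmp d.+2) = 0.
  rewrite /X1 /upd !tmp_eq eqxx.
  by have -> : (d.+2 == d.+3) = false by lia.
have X1e : X1 (tmp d.+3) = 1 by rewrite /X1 /upd eqxx.
have [X2 r [X2c [X2d X2f]]] := mul_loop x o c X1e.
rewrite X1c X1d// in X2c; rewrite X1d// in X2c X2d *.
rewrite X1d// in r.
exists (upd (upd X2 (tmp d.+1) 0) (tmp d) (X2 (tmp d.+2))).
  rewrite (_ : 6 + _ = (1 + 3 * X (tmp d.+1) + 2).+3); last by lia.
  apply: reach_step; first exact: c0.
  apply: reach_step; first exact: c1.
  apply: reach_step; first exact: c2.
  rewrite /= -/X1 X1e /=; apply: reach_trans r _.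
  apply: reach_step; first by rewrite addnC; exact: c6.
  apply: reach_step; first by rewrite /= addnC; exact: c7.
  rewrite /=; set Y := upd X2 _ 0.
  have Y1 : Y (tmp d.+1) = 0 by rewrite /Y /upd eqxx.
  have Y2 : Y (tmp d.+2) = X2 (tmp d.+2).
    by rewrite /Y /upd tmp_eq; have -> : (d.+2 == d.+1) = false by lia.
  by rewrite Y1 Y2 addn0 !addnS; exact: reach0.
split; first by rewrite /upd eqxx.
have X1f : frame d X X1.
  by apply: (@frame_trans _ d _ (upd X (tmp d.+2) 0)) => //; apply: frame_upd; lia.
apply: (frame_trans (leqnn d) X1f).
apply: (frame_trans (leqnn d) X2f).
apply: (@frame_trans _ d _ (upd X2 (tmp d.+1) 0)) => //; apply: frame_upd; lia.
Qed.

Lemma addr_code_ok P q d l X x o : code_at P l (addr_code q d l) ->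
  exists2 X', reach P (9 + 3 * width)
      (Config l X x o) (Config (l + size (addr_code q d l)) X' x o)
    & X' (tmp d) = aaddr q (X (tmp d)) /\ frame d X X'.
Proof.
rewrite /addr_code code_at_cat => -[[c0 _]].
rewrite code_at_cat => -[/=]; rewrite addn1 => c1 [c2 [c3 _]].
set X1 := upd X (tmp d.+1) width.
have X1d : X1 (tmp d) = X (tmp d).
  by rewrite /X1 /upd tmp_eq; have -> : (d == d.+1) = false by lia.
have X1e : X1 (tmp d.+1) = width by rewrite /X1 /upd eqxx.
have [X2 r [X2d X2f]] := mul_code_ok X1 x o c1.
rewrite X1d X1e in r X2d.
set X3 := upd X2 (tmp d.+1) (enum_rank q).+2.
have X3d : X3 (tmp d) = X2 (tmp d).
  by rewrite /X3 /upd tmp_eq; have -> : (d == d.+1) = false by lia.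
have X3e : X3 (tmp d.+1) = (enum_rank q).+2 by rewrite /X3 /upd eqxx.
exists (upd X3 (tmp d) (aaddr q (X (tmp d)))).
  rewrite (_ : 9 + _ = (6 + 3 * width + 2).+1); last by lia.
  apply: reach_step; first exact: c0.
  apply: reach_trans r _.
  apply: reach_step; first exact: c2.
  apply: reach_step; first exact: c3.
  by rewrite /= -/X3 X3d X3e X2d addSnnS -!addnS; exact: reach0.
split; first by rewrite /upd eqxx.
apply: (@frame_trans d d _ X1) => //; first by apply: frame_upd; lia.
apply: (frame_trans (leqnn d) X2f).
by apply: (@frame_trans _ d _ X3) => //; apply: frame_upd; lia.
Qed.

Lemma var_code_ok P y d l X x o : code_at P l (var_code y d l) ->
  exists2 X', reach P 2 (Config l X x o) (Config (l + 2) X' x o)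
    & X' (tmp d) = X (vaddr y) /\ frame d X X'.
Proof.
move=> [c0 [c1 _]]; set X1 := upd X (tmp d) 0.
exists (upd X1 (tmp d) (X (vaddr y))).
  apply: reach_step; first exact: c0.
  apply: reach_step; first exact: c1.
  have X1d : X1 (tmp d) = 0 by rewrite /X1 /upd eqxx.
  rewrite /= -/X1 X1d addn0.
  have -> : X1 (vaddr y) = X (vaddr y).
    by rewrite /X1 /upd; case: eqP => // /vaddr_tmp.
  by rewrite !addnS addn0; exact: reach0.
split; first by rewrite /upd eqxx.
by apply: (@frame_trans d d _ X1) => //; apply: frame_upd; lia.
Qed.

Lemma expr_code_ok P e d l X x o st :
  code_at P l (expr_code e d l) -> sim X st ->
  exists2 X', reach P (expr_cost st e)
      (Config l X x o) (Config (l + size (expr_code e d l)) X' x o)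
    & X' (tmp d) = eval st e /\ frame d X X'.
Proof.
(* [Plus] and [Minus] differ in the last instruction only. The second operand is evaluated one level
   deeper, which protects the first one in [tmp d]. *)
have bin e1 e2 (op : nat -> nat -> nat) a dd ll XX : 
    (forall d l X, code_at P l (expr_code e1 d l) -> sim X st ->
      exists2 X', reach P (expr_cost st e1)
      (Config l X x o) (Config (l + size (expr_code e1 d l)) X' x o)
    & X' (tmp d) = eval st e1 /\ frame d X X') ->
    (forall d l X, code_at P l (expr_code e2 d l) -> sim X st ->
      exists2 X', reach P (expr_cost st e2)
      (Config l X x o) (Config (l + size (expr_code e2 d l)) X' x o)
    & X' (tmp d) = eval st e2 /\ frame d X X') ->
    (forall l X, exec a (Config l X x o) =
      Config l.+1 (upd X (tmp dd) (op (X (tmp dd)) (X (tmp dd.+1)))) x o) ->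
    let c := seq_code (seq_code (expr_code e1 dd) (expr_code e2 dd.+1))
               (fun=> [:: a]) ll in
    code_at P ll c -> sim XX st -> 
    exists2 X', reach P (expr_cost st e1 + expr_cost st e2 + 1)
      (Config ll XX x o) (Config (ll + size c) X' x o)
    & X' (tmp dd) = op (eval st e1) (eval st e2) /\ frame dd XX X'.
  move=> IH1 IH2 opE; rewrite /seq_code /= !code_at_cat => -[[c1 c2] [c3 _]] sX.
  have [X1 r1 [X1d X1f]] := IH1 _ _ _ c1 sX.
  have [X2 r2 [X2d X2f]] := IH2 _ _ _ c2 (frame_sim X1f sX).
  exists (upd X2 (tmp dd) (op (eval st e1) (eval st e2))).
    apply: reach_trans (reach_trans r1 r2) _.
    apply: reach_step; first by rewrite -addnA -size_cat; exact: c3.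
    rewrite opE X2d (frame_tmp _ X2f)// X1d !size_cat /= addn1 !addnS !addnA.
    exact: reach0.
  split; first by rewrite /upd eqxx.
  apply: (frame_trans (leqnn dd) X1f).
  apply: (@frame_trans _ dd _ X2) => //; last exact: frame_upd.
  by move=> j jd; apply: X2f => k ltk; apply: jd; lia.
elim: e d l X => [n|y|e1 IH1 e2 IH2|e1 IH1 e2 IH2|e IH y|q e IH] d l X.
- move=> [c0 _] _; exists (upd X (tmp d) n).
    apply: reach_step; first exact: c0.
    by rewrite /= addn1; exact: reach0.
  by rewrite /upd eqxx; split=> //; exact: frame_upd.
- move=> c sX; have [X' r [X'd X'f]] := var_code_ok X x o c.
  by exists X' => //; rewrite X'd; split=> //; exact: sX.1.
- by apply: (bin _ _ addn).
- by apply: (bin _ _ subn).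
- rewrite /= /seq_code !code_at_cat => -[[c1 c2] c3] sX.
  have [X1 r1 [X1d X1f]] := IH _ _ _ c1 sX.
  have [X2 r2 [X2d X2f]] := var_code_ok X1 x o c2.
  rewrite size_cat addnA in c3.
  have [X3 r3 [X3d X3f]] := mul_code_ok X2 x o c3.
  have X2d' : X2 (tmp d.+1) = var st y.
    by rewrite X2d; exact: (frame_sim X1f sX).1.
  exists X3.
    rewrite X2d' in r3.
    apply: (@reach_le _ (expr_cost st e + 2 + (6 + 3 * var st y))); first by lia.
    by apply: reach_pc (reach_trans (reach_trans r1 r2) r3); rewrite !size_cat /=; lia.
  rewrite X3d X2d' (frame_tmp _ X2f)// X1d; split=> //.
  apply: (frame_trans (leqnn d) X1f).
  apply: (@frame_trans _ d _ X2) => //.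
  by move=> j jd; apply: X2f => k ltk; apply: jd; lia.
- rewrite /= /seq_code code_at_cat => -[]; rewrite code_at_cat.
  move=> [c1 c2] [c3 _] sX.
  have [X1 r1 [X1d X1f]] := IH _ _ _ c1 sX.
  have [X2 r2 [X2d X2f]] := addr_code_ok X1 x o c2.
  exists (upd X2 (tmp d) (arr st q (eval st e))).
    apply: (@reach_le _ (expr_cost st e + (9 + 3 * width) + 1)); first by lia.
    apply: reach_trans (reach_trans r1 r2) _.
    rewrite size_cat addnA in c3.
    apply: reach_step; first exact: c3.
    rewrite /= X2d X1d (frame_sim X2f (frame_sim X1f sX)).2.
    by apply: reach_pc (reach0 _ _ _); rewrite !size_cat /=; lia.
  split; first by rewrite /upd eqxx.
  apply: (frame_trans (leqnn d) X1f).
  by apply: (@frame_trans _ d _ X2) => //; exact: frame_upd.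
Qed.

(** The analogue of [frame] for statements: these change variables and arrays, so survival is only
    required of the temporaries below [d]. *)
Definition tmp_frame (d : nat) (X Y : nat -> nat) :=
  forall k, k < d -> Y (tmp k) = X (tmp k).

Lemma frame_tmp_frame d d' X Y : d' <= d -> frame d X Y -> tmp_frame d' X Y.
Proof. by move=> led XY k ltk; apply: frame_tmp XY; apply: leq_trans led. Qed.

Lemma sim_setv X st y v : sim X st -> sim (upd X (vaddr y) v) (setv st y v).
Proof.
move=> [sv sa]; split=> [z|q i]; rewrite /upd /=.
  by rewrite (inj_eq vaddr_inj) -sv.
by case: eqP => // e; case: (@vaddr_aaddr y q i).
Qed.

Lemma sim_seta X st q i v : sim X st -> sim (upd X (aaddr q i) v) (seta st q i v).
Proof.
move=> [sv sa]; split=> [z|q' i']; rewrite /upd /=.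
  by case: eqP => // e; case: (@vaddr_aaddr z q i).
rewrite -sa; case: eqP => [/aaddr_inj[-> ->]|ne]; first by rewrite !eqxx.
by case: eqP => //= eq; case: eqP => //= ei; rewrite eq ei in ne.
Qed.

Lemma loop_snd {A : Type} (f : nat -> A -> A) (g : nat -> A -> nat) n a c :
  let h k (p : A * nat) := (f k p.1, p.2 + g k p.1) in
  (loop h n (a, c)).2 = c + (loop h n (a, 0)).2.
Proof.
move=> h; elim: n a c => [|n IHn] a c /=; first by rewrite addn0.
by rewrite IHn [in RHS]IHn addnA.
Qed.

Definition for_cost y s n st :=
  (loop (fun k st' => (sem s (setv st'.1 y k),
           st'.2 + (stmt_cost s (setv st'.1 y k) + 5))) n (st, 0)).2.

Lemma for_costS y s n st : for_cost y s n.+1 st =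
  stmt_cost s (setv st y n) + 5 + for_cost y s n (sem s (setv st y n)).
Proof.
rewrite /for_cost /= add0n.
exact: (loop_snd (fun k st' => sem s (setv st' y k))
          (fun k st' => stmt_cost s (setv st' y k) + 5)).
Qed.

(** Induction on the counter in [tmp d], starting from the test behind the body, so that a zero
    bound skips the body. The counter survives an iteration because the body preserves all
    temporaries below [d.+1]. *)
Lemma for_ok P y s d l c :
  code_at P (l + 2) ([:: Const (tmp d.+1) 1; Defs.Sub (tmp d) (tmp d) (tmp d.+1);
    Const (tmp d.+1) 0; Defs.Add (vaddr y) (tmp d) (tmp d.+1)] ++ c ++
    [:: JumpPos (l + 2) (tmp d)]) ->
  (forall X st, sim X st -> exists2 X', reach P (stmt_cost s st)
      (Config (l + 6) X (inp st) (out st))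
      (Config (l + 6 + size c) X' (inp (sem s st)) (out (sem s st)))
    & sim X' (sem s st) /\ tmp_frame d.+1 X X') ->
  forall X st, sim X st -> forall n, X (tmp d) = n ->
  let st' := loop (fun k st' => sem s (setv st' y k)) n st in
  exists2 X', reach P (for_cost y s n st).+1
      (Config (l + 6 + size c) X (inp st) (out st))
      (Config (l + 6 + size c).+1 X' (inp st') (out st'))
    & sim X' st' /\ tmp_frame d X X'.
Proof.
move=> /= [c4 [c5 [c6 [c7]]]]; rewrite code_at_cat => -[_ [c9 _]] IH X st sX n.
rewrite (_ : (l + 2).+4 = l + 6) in c9; last by lia.
elim: n X st sX => [|n IHn] X st sX Xn.
  exists X => //; apply: reach_step; first exact: c9.
  by rewrite /= Xn; exact: reach0.
set X1 := upd X (tmp d.+1) 1; set X2 := upd X1 (tmp d) n.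
set X3 := upd X2 (tmp d.+1) 0; set X4 := upd X3 (vaddr y) n.
have X1d : X1 (tmp d) = n.+1.
  by rewrite /X1 /upd tmp_eq; have -> : (d == d.+1) = false by lia.
have X1e : X1 (tmp d.+1) = 1 by rewrite /X1 /upd eqxx.
have X3d : X3 (tmp d) = n.
  rewrite /X3 /X2 /upd !tmp_eq eqxx.
  by have -> : (d == d.+1) = false by lia.
have X3e : X3 (tmp d.+1) = 0 by rewrite /X3 /upd eqxx.
have X3f : frame d X X3.
  apply: (@frame_trans _ d _ X1) => //; first by apply: frame_upd; lia.
  by apply: (@frame_trans _ d _ X2) => //; apply: frame_upd; lia.
have sX4 : sim X4 (setv st y n) by exact/sim_setv/(frame_sim X3f).
have X4t k : X4 (tmp k) = X3 (tmp k).
  by rewrite /X4 /upd; case: eqP => // e; case: (@vaddr_tmp y k).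
have [X5 r5 [sX5 X5f]] := IH _ _ sX4.
have X5d : X5 (tmp d) = n by rewrite X5f// X4t.
have [X6 r6 [sX6 X6f]] := IHn _ _ sX5 X5d.
exists X6; last first.
  split; first exact: sX6.
  by move=> k ltk; rewrite X6f// X5f; [rewrite X4t (frame_tmp ltk X3f)|exact: ltnW].
rewrite for_costS.
apply: (@reach_le _ (stmt_cost s (setv st y n) +
  (for_cost y s n (sem s (setv st y n))).+1).+4.+1); first by lia.
apply: reach_step; first exact: c9.
rewrite /= Xn /=.
apply: reach_step; first exact: c4.
apply: reach_step; first exact: c5.
apply: reach_step; first exact: c6.
apply: reach_step; first exact: c7.
rewrite /= -/X1 X1d X1e subn1 /= -/X2 -/X3 X3d X3e addn0 -/X4.
rewrite (_ : (l + 2).+4 = l + 6); last by lia.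
exact: reach_trans r5 r6.
Qed.

Lemma stmt_code_ok P s d l X st :
  code_at P l (stmt_code s d l) -> sim X st ->
  let st' := sem s st in
  exists2 X', reach P (stmt_cost s st) (Config l X (inp st) (out st))
      (Config (l + size (stmt_code s d l)) X' (inp st') (out st'))
    & sim X' st' /\ tmp_frame d X X'.
Proof.
elim: s d l X st => [|y e|q e1 e2|s1 IH1 s2 IH2|e s IH|y n s IH|y|e] d l X st.
- by move=> _ sX; exists X; rewrite /= ?addn0; first exact: reach0.
- rewrite /= /seq_code code_at_cat => -[c1 [c2 [c3 _]]] sX.
  have [X1 r1 [X1d X1f]] := expr_code_ok (inp st) (out st) c1 sX.
  set X2 := upd X1 (tmp d.+1) 0.
  have X2f : frame d X1 X2 by apply: frame_upd; lia.
  exists (upd X2 (vaddr y) (eval st e)).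
    apply: reach_trans r1 _.
    apply: reach_step; first exact: c2.
    apply: reach_step; first exact: c3.
    rewrite /= -/X2 (_ : X2 (tmp d) = X1 (tmp d)); last first.
      by rewrite /X2 /upd tmp_eq; have -> : (d == d.+1) = false by lia.
    have X2e : X2 (tmp d.+1) = 0 by rewrite /X2 /upd eqxx.
    rewrite X1d X2e addn0.
    by rewrite size_cat /= !addnS addn0; exact: reach0.
  split; first exact/sim_setv/(frame_sim X2f)/(frame_sim X1f).
  move=> k ltk; rewrite -(frame_tmp ltk X1f) -(frame_tmp ltk X2f) /upd.
  by case: eqP => // e'; case: (@vaddr_tmp y k).
- rewrite /= /seq_code code_at_cat => -[]; rewrite code_at_cat => -[].
  rewrite code_at_cat => -[c1 c2] c3 [c4 _] sX.
  have [X1 r1 [X1d X1f]] := expr_code_ok (inp st) (out st) c1 sX.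
  have [X2 r2 [X2d X2f]] := addr_code_ok X1 (inp st) (out st) c2.
  have sX2 := frame_sim X2f (frame_sim X1f sX).
  have [X3 r3 [X3d X3f]] := expr_code_ok (inp st) (out st) c3 sX2.
  rewrite size_cat addnA in r3.
  exists (upd X3 (aaddr q (eval st e1)) (eval st e2)).
    apply: (@reach_le _ (expr_cost st e1 + (9 + 3 * width) +
      expr_cost st e2 + 1)); first by lia.
    apply: reach_trans (reach_trans (reach_trans r1 r2) r3) _.
    rewrite 2!size_cat !addnA in c4.
    apply: reach_step; first exact: c4.
    rewrite /= X3d (frame_tmp _ X3f)// X2d X1d.
    by rewrite 3!size_cat !addnA addn1; exact: reach0.
  split; first exact/sim_seta/(frame_sim X3f).
  move=> k ltk; rewrite -(frame_tmp ltk X1f) -(frame_tmp ltk X2f).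
  rewrite -(frame_tmp (leqW ltk) X3f) /upd.
  by case: eqP => // e'; case: (@aaddr_tmp q (eval st e1) k).
- rewrite /= /seq_code !code_at_cat => -[c1 c2] sX.
  have [X1 r1 [sX1 X1f]] := IH1 _ _ _ _ c1 sX.
  have [X2 r2 [sX2 X2f]] := IH2 _ _ _ _ c2 sX1.
  exists X2; first by rewrite size_cat addnA; exact: reach_trans r1 r2.
  by split=> // k ltk; rewrite X2f// X1f.
- rewrite /= /seq_code code_at_cat => -[c1 /= [c2 [c3 [c4 c5]]]] sX.
  have [X1 r1 [X1d X1f]] := expr_code_ok (inp st) (out st) c1 sX.
  rewrite size_cat /= !addnA; move: r1 c2 c3 c4 c5.
  set l1 := l + _ => r1 c2 c3 c4 c5; have sX1 := frame_sim X1f sX.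
  case: ltnP => [e_gt0|e_le0].
    rewrite -!addSnnS -[l1.+3]addn3 addn0 in c5 *.
    have [X2 r2 [sX2 X2f]] := IH _ _ _ _ c5 sX1.
    exists X2; last first.
      by split=> // k ltk; rewrite X2f// -(frame_tmp ltk X1f).
    apply: (@reach_le _ (expr_cost st e + (stmt_cost s st).+1)); first by lia.
    apply: reach_trans r1 _.
    apply: reach_step; first exact: c2.
    by rewrite /= X1d e_gt0.
  exists (upd X1 (tmp d) 1).
    apply: (@reach_le _ (expr_cost st e + 3)); first by lia.
    apply: reach_trans r1 _.
    apply: reach_step; first exact: c2.
    rewrite /= X1d ltnNge e_le0 /=.
    apply: reach_step; first exact: c3.
    apply: reach_step; first exact: c4.
    set X2 := upd X1 _ _; have X2e : X2 (tmp d) = 1 by rewrite /X2 /upd eqxx.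
    by rewrite /= X2e /= !addnS !addn0 !addSn; exact: reach0.
  have f2 : frame d X1 (upd X1 (tmp d) 1) by exact: frame_upd.
  split; first exact: frame_sim f2 sX1.
  exact/(frame_tmp_frame (leqnn d))/(frame_trans (leqnn d) X1f).
- rewrite [stmt_code _ _ _]/= /seq_code code_at_cat => -[c1].
  change (size (var_code n d l)) with 2.
  set l1 := l + 2; set c := stmt_code _ _ _ => -[c2 [c3 c4]] sX.
  have [X1 r1 [X1d X1f]] := var_code_ok X (inp st) (out st) c1.
  set X2 := upd X1 (tmp d.+1) 1.
  have X2f : frame d X1 X2 by apply: frame_upd; lia.
  have X2d : X2 (tmp d) = var st n.
    rewrite /X2 /upd tmp_eq; have -> : (d == d.+1) = false by lia.
    by rewrite X1d; exact: sX.1.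
  have sX2 : sim X2 st by apply: frame_sim X2f _; exact: frame_sim X1f sX.
  have tX2 : tmp_frame d X X2.
    exact/(frame_tmp_frame (leqnn d))/(frame_trans (leqnn d) X1f).
  have [||X' r [sX' X'f]] := @for_ok P y s d l1 c _ _ X2 st sX2 (var st n) X2d.
  + by rewrite -[l1.+2]addn2 in c4.
  + move=> X' st' sX'; apply: IH => //.
    move: c4 => [_ [_ [_ [_ ]]]]; rewrite -/code_at code_at_cat => -[c5 _].
    by rewrite (_ : l1.+2.+4 = l1 + 6) in c5; last lia.
  exists X'; last by split=> // k ltk; rewrite X'f// tX2.
  apply: (@reach_le _ (2 + (for_cost y s (var st n) st).+3)); first by rewrite [stmt_cost _ _]/= -/(for_cost y s (var st n) st); lia.
  apply: reach_trans r1 _.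
  apply: reach_step; first exact: c2.
  apply: reach_step; first exact: c3.
  have X2e : X2 (tmp d.+1) = 1 by rewrite /X2 /upd eqxx.
  rewrite /= -/X2 X2e /=; apply: reach_pc r.
  by rewrite /= size_cat /= /l1; lia.
- move=> [c0 _] sX; exists (upd X (vaddr y) (head 0 (inp st))).
    apply: reach_step; first exact: c0.
    by rewrite /= addn1; exact: reach0.
  split; first exact: sim_setv.
  by move=> k ltk; rewrite /upd; case: eqP => // e'; case: (@vaddr_tmp y k).
- rewrite /= /seq_code code_at_cat => -[c1 [c2 _]] sX.
  have [X1 r1 [X1d X1f]] := expr_code_ok (inp st) (out st) c1 sX.
  exists X1; last first.
    by split; [exact: frame_sim X1f sX | exact: frame_tmp_frame X1f].
  apply: reach_trans r1 _; apply: reach_step; first exact: c2.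
  by rewrite /= X1d; apply: reach_pc (reach0 _ _ _); rewrite size_cat /=; lia.
Qed.

Definition init_state (x : seq nat) : state :=
  State (fun=> 0) (fun _ _ => 0) x [::].

Lemma stmt_code_halts s x :
  exists2 t, t <= stmt_cost s (init_state x) &
  halts_in (stmt_code s 0 0) x t (out (sem s (init_state x))).
Proof.
have c : code_at (stmt_code s 0 0) 0 (stmt_code s 0 0) by exact: code_at_self [::].
have [|X [t tle r] _] := @stmt_code_ok _ s 0 0 (fun=> 0) (init_state x) c.
  by split.
exists t => //; exists (Config (0 + size (stmt_code s 0 0)) X
  (inp (sem s (init_state x))) (out (sem s (init_state x)))).
(* Control ends just past the last instruction, which is how the machine halts. *)
by split=> //; rewrite /step /= onth_default.
Qed.

(** * A syntactic criterion for polynomial cost *)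

(* [steady v s]: [s] never changes [v], and all its loops and multiplications
   are controlled by [v], so its cost is bounded by a polynomial in [v]. *)
Fixpoint steady_expr (v : V) (e : expr) : bool :=
  match e with
  | Cst _ | Var _ => true
  | Plus e1 e2 | Minus e1 e2 => steady_expr v e1 && steady_expr v e2
  | Scale e x => steady_expr v e && (x == v)
  | Get q e => steady_expr v e
  end.

Fixpoint steady (v : V) (s : stmt) : bool :=
  match s with
  | Skip => true
  | Assign x e => (x != v) && steady_expr v e
  | Put q i e => steady_expr v i && steady_expr v e
  | Seq s1 s2 => steady v s1 && steady v s2
  | If e s1 => steady_expr v e && steady v s1
  | For x n s1 => [&& x != v, n == v & steady v s1]
  | In x => x != v
  | Out e => steady_expr v e
  end.

Lemma steady_var v s st : steady v s -> var (sem s st) v = var st v.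
Proof.
elim: s st => //= [x e|s1 IH1 s2 IH2|e s IH|x n s IH|x] st.
- by rewrite eq_sym => /andP[/negbTE->].
- by case/andP=> ? ?; rewrite IH2// IH1.
- by case/andP=> _ ?; case: ifP => // _; rewrite IH.
- case/and3P=> nx _ sv.
  apply: (loop_ind (I := fun _ st' => var st' v = var st v)) => // k st' _ <-.
  by rewrite IH//= eq_sym (negbTE nx).
- by rewrite eq_sym => /negbTE->.
Qed.

Lemma steady_expr_cost v e : steady_expr v e ->
  exists a, forall st, expr_cost st e <= a * (var st v).+1.
Proof.
elim: e => [n|x|e1 IH1 e2 IH2|e1 IH1 e2 IH2|e IH x|q e IH] /=.
- by exists 1 => st; lia.
- by exists 2 => st; lia.
- case/andP=> /IH1[a1 H1] /IH2[a2 H2]; exists (a1 + a2 + 1) => st.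
  by have := H1 st; have := H2 st; lia.
- case/andP=> /IH1[a1 H1] /IH2[a2 H2]; exists (a1 + a2 + 1) => st.
  by have := H1 st; have := H2 st; lia.
- case/andP=> /IH[a H] /eqP->; exists (a + 11) => st; have := H st; lia.
- move=> /IH[a H]; exists (a + (10 + 3 * width)) => st; have := H st; lia.
Qed.

Lemma steady_cost v s : steady v s ->
  exists a d, forall st, stmt_cost s st <= a * (var st v).+1 ^ d.
Proof.
have up a d d' n : d <= d' -> a * n.+1 ^ d <= a * n.+1 ^ d'.
  by move=> led; rewrite leq_mul2l leq_pexp2l ?orbT.
have up1 a d n : a * n.+1 <= a * n.+1 ^ d.+1.
  by rewrite -{1}[n.+1]expn1; exact: up.
have up0 a d n : a <= a * n.+1 ^ d.
  by rewrite -{1}[a]muln1 leq_mul2l expn_gt0 orbT.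
elim: s => [|x e|q e1 e2|s1 IH1 s2 IH2|e s IH|x n s IH|x|e] /=.
- by exists 0, 0.
- case/andP=> _ /steady_expr_cost[a H]; exists (a + 2), 1 => st.
  by have := H st; rewrite expn1; lia.
- case/andP=> /steady_expr_cost[a H] /steady_expr_cost[b G].
  exists (a + b + (10 + 3 * width)), 1 => st.
  by have := H st; have := G st; rewrite expn1; lia.
- case/andP=> sv /IH2[b [d' G]]; have [a [d H]] := IH1 sv.
  exists (a + b), (d + d') => st; rewrite mulnDl leq_add//.
    exact/(leq_trans (H _))/up/leq_addr.
  apply: leq_trans (G _) _; rewrite steady_var//; exact/up/leq_addl.
- case/andP=> /steady_expr_cost[a H] /IH[b [d G]].
  exists (a + 3 + b), d.+1 => st; rewrite addnA 2!mulnDl.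
  rewrite !leq_add ?up0//; first exact/(leq_trans (H _))/up1.
  exact/(leq_trans (G _))/up.
- case/and3P=> nx /eqP-> sv; have [a [d H]] := IH sv.
  (* There are [v] iterations, each costing the bound for the body plus 5 for loop control, and 5
     more steps on entry; [a + 10] absorbs both fives. *)
  exists (a + 10), d.+1 => st; rewrite -/(for_cost x s (var st v) st).
  suff le k st' : k <= var st v -> var st' v = var st v ->
      for_cost x s k st' <= k * (a * (var st v).+1 ^ d + 5).
    have := le _ st (leqnn _) erefl; move: (for_cost _ _ _ _) => c.
    by rewrite expnS; have := up0 1 d (var st v); nia.
  elim: k st' => [|k IHk] st' lek st'v; first by [].
  rewrite for_costS mulSn leq_add//; last first.
    by rewrite IHk ?(ltnW lek)// steady_var//= eq_sym (negbTE nx).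
  rewrite leq_add2r; apply: leq_trans (H _) _.
  by rewrite /= eq_sym (negbTE nx) st'v.
- by exists 1, 0.
- move=> /steady_expr_cost[a H]; exists (a + 1), 1 => st.
  by have := H st; rewrite expn1; lia.
Qed.

End Language.


(** * Splitting common separable patterns *)

(** The Boolean selects the order or its reverse. Reversing the values exchanges 2413 with 3142 and
    direct with skew sums, so one argument covers both. *)
Definition ord (b : bool) (x y : nat) : bool := if b then x < y else y < x.

(* [b = true] excludes 2413 and [b = false] excludes 3142. *)
Definition separable_word (n : nat) (v : nat -> nat) : Prop :=
  forall b i j k l, i < j -> j < k -> k < l -> l < n ->
  ord b (v k) (v i) -> ord b (v i) (v l) -> ord b (v l) (v j) -> False.

Definition cut (v : nat -> nat) (b : bool) (i k j : nat) : Prop :=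
  forall a c, i <= a -> a < k -> k <= c -> c < j -> ord b (v a) (v c).

Lemma forall_or_exists (i j : nat) (p : pred nat) :
  (forall a, i <= a -> a < j -> p a) \/ exists a, [/\ i <= a, a < j & ~~ p a].
Proof.
have [/allP h|/allPn[a]] := boolP (all p (index_iota i j)).
  by left=> a le lt; apply: h; rewrite mem_index_iota le.
by rewrite mem_index_iota => /andP[le lt] pa; right; exists a.
Qed.

Lemma ordN b x y : x <> y -> ~~ ord b x y -> ord b y x.
Proof. by case: b => /=; lia. Qed.

Lemma ord_trans b y x z : ord b x y -> ord b y z -> ord b x z.
Proof. by case: b => /=; lia. Qed.

Lemma ord_negb b x y : ord (~~ b) x y = ord b y x.
Proof. by case: b. Qed.

(* Induction on the interval: split it without its last element [x], at the least
   possible [k]. If neither [k] nor the position of [x] splits the whole, then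
   the part before [k] splits the other way, by minimality, and one element of
   each of its parts, the element at [k] and [x] form a forbidden pattern. *)
Lemma interval_split n v : separable_word n v ->
  (forall i j, i < j -> j < n -> v i <> v j) ->
  forall i j, i.+1 < j -> j <= n ->
  exists b k, [/\ i < k, k < j & cut v b i k j].
Proof.
move=> sv v_inj i j; move: {2}(j - i) (leqnn (j - i)) => m.
elim: m i j => [|m IHm] i j; first by lia.
case: j => // j lem ltij lejn.
have [eq_j|ne_j] := eqVneq j i.+1.
  exists (v i < v j), j; split; [lia|lia|] => a c ? ? ? ?.
  have -> : a = i by lia.
  have -> : c = j by lia.
  have : v i <> v j by apply: v_inj; lia.
  by rewrite /ord; case: ltnP => //; lia.
have [b [k [ltik ltkj ck]]] := IHm i j ltac:(lia) ltac:(lia) ltac:(lia).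
(* Strong induction on the cut stands in for the choice of a least one. *)
elim/ltn_ind: k ltik ltkj ck => k IHk ltik ltkj ck.
have [eq_k|ne_k] := eqVneq k i.+1.
  have [lt_ij|/ordN nlt_ij] := boolP (ord b (v i) (v j)).
    exists b, k; split; [lia|lia|move=> a c leia ltak lekc ltcj].
    have -> : a = i by lia.
    have [->//|ne] := eqVneq c j.
    by apply: ck; lia.
  have {}nlt_ij : ord b (v j) (v i) by apply: nlt_ij; apply: v_inj; lia.
  exists (~~ b), j; split; [lia|lia|move=> a c leia ltak lekc ltcj].
  have -> : c = j by lia.
  rewrite ord_negb; have [->//|ne] := eqVneq a i.
  by apply: ord_trans nlt_ij _; apply: ck; lia.
have [b' [k' [ltik' ltkk' ck']]] := IHm i k ltac:(lia) ltac:(lia) ltac:(lia).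
(* If the part before [k] is cut in the same direction, then [k'] is a smaller cut of the whole
   interval without its last element. *)
have [eq_b|ne_b] := eqVneq b' b.
  apply: (IHk k'); [lia|lia|lia|move=> a c leia ltak lekc ltcj].
  have [ltck|lekc'] := ltnP c k; first by rewrite -eq_b; apply: ck'.
  by apply: ck => //; lia.
have eq_b : b' = ~~ b by case: b b' ne_b {ck ck' IHk} => [] [].
rewrite eq_b in ck'.
have [below|[a [leia ltak]]] := forall_or_exists i k (fun a => ord b (v a) (v j)).
  exists b, k; split; [lia|lia|move=> a c leia ltak lekc ltcj].
  have [->|ne] := eqVneq c j; first by apply: below.
  by apply: ck => //; lia.
move=> /ordN xa; have {}xa : ord b (v j) (v a) by apply: xa; apply: v_inj; lia.
have [above|[y [leiy ltyk]]] := forall_or_exists i k (fun a => ord b (v j) (v a)).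
  exists (~~ b), j; split; [lia|lia|move=> a' c leia' ltak' lekc ltcj].
  have -> : c = j by lia.
  rewrite ord_negb; have [ltak''|leka'] := ltnP a' k; first by apply: above.
  by apply: ord_trans (above i _ _) _ => //; apply: ck; lia.
move=> /ordN yx.
have {}yx : ord b (v y) (v j) by apply: yx; have := @v_inj y j; lia.
(* The parts of [[i, k)] at [k'] are in the reverse order. So a witness above the last element can
   be moved into the first part, and one below it into the second. *)
have [a' [leia' lta'k' xa']] : exists a', [/\ i <= a', a' < k' & ord b (v j) (v a')].
  have [?|?] := ltnP a k'; first by exists a.
  exists i; split=> //; apply: ord_trans xa _; rewrite -ord_negb.
  by apply: ck'.
have [y' [lek'y' lty'k y'x]] : exists y', [/\ k' <= y', y' < k & ord b (v y') (v j)].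
  have [?|?] := ltnP y k'; last by exists y.
  exists k'; split=> //; apply: ord_trans yx; rewrite -ord_negb.
  by apply: ck'.
case: (sv (~~ b) a' y' k j); rewrite ?ord_negb //; [lia|].
by apply: ck; lia.
Qed.

(** * Boxes and sums of common patterns *)

Section Good.

Variables (I : finType).
Implicit Types (a : I -> nat -> nat) (x : nat -> I -> nat).

(* [x 0, ..., x (n - 1)] are the elements of a common separable pattern: [x i q]
   is the position of element [i] in the word [a q], whose zero entries are
   blanks. *)
Record good a (n : nat) x : Prop := Good {
  good_pos : forall i q, i < n -> 0 < a q (x i q);
  good_incr : forall i j q, i < j -> j < n -> x i q < x j q;
  good_dir : forall i j, i < j -> j < n ->
    exists b, forall q, ord b (a q (x i q)) (a q (x j q));
  good_sep : forall q, separable_word n (fun i => a q (x i q)) }.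

(* A box is given by, for every [q], an interval of positions (first component
   [false]) and of values ([true]); the second component selects the lower
   (inclusive) or the upper (exclusive) end. *)
Definition box := bool * bool * I -> nat.

Definition fits a (g : box) (i j : nat) x : Prop :=
  forall l q, i <= l -> l < j ->
    g (false, false, q) <= x l q < g (false, true, q) /\
    g (true, false, q) <= a q (x l q) < g (true, true, q).

(* For [m] in the box, [sub true d g m] and [sub false (~~ d) g m] are the parts
   of [g] for a direct ([d = true]) or skew sum, in the order of positions. *)
Definition sub {T : Type} (d e : bool) (g : bool * bool * I -> T)
    (m : bool * I -> T) (c : bool * bool * I) : T :=
  if c.1.2 == (if c.1.1 then e else d) then m (c.1.1, c.2) else g c.

Definition inbox (g : box) (m : bool * I -> nat) : Prop :=
  forall ax q, g (ax, false, q) <= m (ax, q) <= g (ax, true, q).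

Definition ach a (g : box) (n : nat) : Prop :=
  exists x, good a n x /\ fits a g 0 n x.

Lemma ach0 a g : ach a g 0.
Proof. by exists (fun=> fun=> 0); split=> //; split=> // q b i j k l *; lia. Qed.

Lemma ach1 a g h : (forall q, 0 < a q (h q)) -> fits a g 0 1 (fun=> h) -> ach a g 1.
Proof.
move=> h0 fh; exists (fun=> h); split=> //.
by split=> [//|i j q|i j|q b i j k l] *; lia.
Qed.

(** Soundness of the update. The two boxes are separated by [m] in positions and in values for every
    [q], so juxtaposing the patterns gives the same sum in all words. *)
Lemma ach_add a g m d n1 n2 : inbox g m ->
  ach a (sub true d g m) n1 -> ach a (sub false (~~ d) g m) n2 ->
  ach a g (n1 + n2).
Proof.
move=> gm [x1 [[p1 i1 d1 s1] f1]] [x2 [[p2 i2 d2 s2] f2]].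
pose x i := if i < n1 then x1 i else x2 (i - n1).
have xl i : i < n1 -> x i = x1 i by rewrite /x => ->.
have xr i : n1 <= i -> x i = x2 (i - n1) by rewrite /x ltnNge => ->.
have cross i j q : i < n1 -> n1 <= j -> j < n1 + n2 ->
    x i q < x j q /\ ord d (a q (x i q)) (a q (x j q)).
  move=> lti lej ltj; rewrite (xl _ lti) (xr _ lej).
  have [] := f1 i q isT lti; have [] := f2 (j - n1) q isT ltac:(lia).
  by rewrite /sub /ord /=; case: (d) => /=; lia.
have part i q : i < n1 + n2 ->
    (0 < a q (x i q)) /\ g (false, false, q) <= x i q < g (false, true, q) /\
    g (true, false, q) <= a q (x i q) < g (true, true, q).
  move=> lti; have := gm false q; have := gm true q.
  have [lti1|lei] := ltnP i n1.
    rewrite (xl _ lti1); have := p1 i q lti1; have := f1 i q isT lti1.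
    by rewrite /sub /=; case: (d) => /=; lia.
  have lti2 : i - n1 < n2 by lia.
  rewrite (xr _ lei); have := p2 _ q lti2; have := f2 _ q isT lti2.
  by rewrite /sub /=; case: (d) => /=; lia.
exists x; split; last by move=> l q _ ltl; have [_] := part l q ltl.
split=> [i q /(part i q)[]//|i j q ltij ltj|i j ltij ltj|q b i j k l ltij ltjk ltkl ltl].
- have [ltj1|lej] := ltnP j n1; first by rewrite !xl ?i1//; lia.
  have [lti1|lei] := ltnP i n1; first by have [] := cross i j q lti1 lej ltj.
  by rewrite !xr// i2//; lia.
- have [ltj1|lej] := ltnP j n1; first by rewrite !xl ?d1//; [apply: d1|]; lia.
  have [lti1|lei] := ltnP i n1.
    by exists d => q; have [] := cross i j q lti1 lej ltj.
  by rewrite !xr//; apply: d2; lia.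
(* A forbidden occurrence lies within one summand: neither 2413 nor 3142 is a direct or skew sum, so
   an occurrence across the boundary contradicts [cross]. *)
- have [ltl1|lel] := ltnP l n1; first by rewrite !xl; [apply: s1; lia|lia..].
  have [lti1|lei] := ltnP i n1; last by rewrite !xr; [apply: s2; lia|lia..].
  have [_ il] := cross i l q lti1 lel ltl.
  have [ltk1|lek] := ltnP k n1.
    have ltj1 : j < n1 by lia.
    have [_ ] := cross j l q ltj1 lel ltl.
    have [_ ] := cross k l q ltk1 lel ltl.
    by move: il; rewrite /ord; case: (d); case: (b); lia.
  have [_ ik] := cross i k q lti1 lek ltac:(lia).
  by move: il ik; rewrite /ord; case: (d); case: (b); lia.
Qed.

Lemma good_inj a n x q i j : good a n x -> i < j -> j < n ->
  a q (x i q) <> a q (x j q).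
Proof.
move=> gx ltij ltj; have [b /(_ q)] := good_dir gx ltij ltj.
by rewrite /ord; case: b; lia.
Qed.

(** This transfers a split found in the word of [q0] to all other words. *)
Lemma good_ord a n x b i j q q' : good a n x -> i < n -> j < n ->
  ord b (a q (x i q)) (a q (x j q)) -> ord b (a q' (x i q')) (a q' (x j q')).
Proof.
move=> gx lti ltj; have [ltij|ltji|->] := ltngtP i j; last by case: b => /=; lia.
  have [b' h] := good_dir gx ltij ltj; have := h q; have := h q'.
  by case: b b' {h} => [] [] /=; lia.
have [b' h] := good_dir gx ltji lti; have := h q; have := h q'.
by case: b b' {h} => [] [] /=; lia.
Qed.

Lemma leq_max_interval (F : nat -> nat) i j l :
  i <= l -> l < j -> F l <= \max_(i <= r < j) F r.
Proof.
move=> lei ltj; apply: (@leq_bigmax_seq _ _ xpredT F) => //.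
by rewrite mem_index_iota lei.
Qed.

Lemma max_interval_ltn (F : nat -> nat) i j M : 0 < M ->
  (forall l, i <= l -> l < j -> F l < M) -> \max_(i <= r < j) F r < M.
Proof.
case: M => // M _ h; rewrite ltnS; apply/bigmax_leqP_seq => l.
by rewrite mem_index_iota => /andP[lei ltj] _; exact: h.
Qed.

Lemma fits_split a n x g (q0 : I) i j : good a n x -> fits a g i j x ->
  i.+1 < j -> j <= n ->
  exists d k m, [/\ i < k, k < j, inbox g m,
    fits a (sub true d g m) i k x & fits a (sub false (~~ d) g m) k j x].
Proof.
move=> gx fx ltij lejn.
have v_inj i' j' : i' < j' -> j' < n -> a q0 (x i' q0) <> a q0 (x j' q0).
  exact: good_inj gx.
have [d [k [ltik ltkj ck]]] := interval_split (@good_sep _ _ _ gx q0) v_inj ltij lejn.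
have {}ck q l r : i <= l -> l < k -> k <= r -> r < j ->
    ord d (a q (x l q)) (a q (x r q)).
  move=> ? ? ? ?; apply: (@good_ord a n x d l r q0 q gx); [lia|lia|].
  exact: ck.
(* The elements from [lo] to [hi] form the part with the smaller values, which comes first or second
   according to [d]. The split point has the position of the first element of the second part, and
   as value the successor of the maximum over the lower part; this fits the exclusive upper and
   inclusive lower ends. *)
pose lo := if d then i else k; pose hi := if d then k else j.
pose m (c : bool * I) : nat :=
  if c.1 then (\max_(lo <= l < hi) a c.2 (x l c.2)).+1 else x k c.2.
have lo_hi l q : lo <= l -> l < hi -> a q (x l q) < m (true, q).
  by rewrite ltnS => lel ltl; apply: (leq_max_interval (fun r => a q (x r q))).
have m_lt q M : (forall l, lo <= l -> l < hi -> a q (x l q) < M) -> m (true, q) <= M.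
  move=> h; apply: max_interval_ltn (h).
  by apply: leq_ltn_trans (h lo _ _); rewrite /lo /hi; case: (d); lia.
have [ilo lohi hij] : [/\ i <= lo, lo < hi & hi <= j].
  by rewrite /lo /hi; case: (d); split; lia.
have gm : inbox g m.
  case=> q; last by have [||? _] := fx k q; rewrite /m /=; lia.
  apply/andP; split; last first.
    by apply: m_lt => l lel ltl; have [||_ /andP[]//] := fx l q; lia.
  have [||_ /andP[h _]] := fx lo q; [lia|lia|].
  exact/(leq_trans h)/ltnW/lo_hi.
exists d, k, m; split=> // l q lel ltl.
  have [||h1 h2] := fx l q; [lia|lia|].
  have := @good_incr _ _ _ gx l k q ltl ltac:(lia).
  rewrite /sub /=; move: lo_hi m_lt; rewrite /lo /hi; case: (d) ck => ck lo_hi m_lt /=.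
    by have := lo_hi l q lel ltl; rewrite /m /=; lia.
  have := m_lt q (a q (x l q)) (fun r h h' => ck q l r lel ltl h h').
  by rewrite /m /=; lia.
have [||h1 h2] := fx l q; [lia|lia|].
have : x k q <= x l q.
  have [->//|ne] := eqVneq k l.
  by apply: ltnW; apply: (@good_incr _ _ _ gx); lia.
rewrite /sub /=; move: lo_hi m_lt; rewrite /lo /hi; case: (d) ck => ck lo_hi m_lt /=.
  have := m_lt q (a q (x l q)) (fun r h h' => ck q r l h h' lel ltl).
  by rewrite /m /=; lia.
by have := lo_hi l q lel ltl; rewrite /m /=; lia.
Qed.

End Good.


(** * Words and permutations *)

Lemma size_word s : size (word s) = plength s.
Proof. by rewrite size_map size_enum_ord. Qed.

Lemma nth_word s (i : 'I_(plength s)) : nth 0 (word s) i = (tagged s i).+1.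
Proof. by rewrite (nth_map i) ?size_enum_ord// nth_ord_enum. Qed.

Lemma nth_word_gt0 s j : 0 < nth 0 (word s) j -> j < plength s.
Proof. by rewrite -size_word; case: (ltnP j) => // lej; rewrite nth_default. Qed.

(** Each value is replaced by its rank, the number of smaller values. *)
Lemma standardize n (v : nat -> nat) :
  (forall i j, i < j -> j < n -> v i <> v j) ->
  exists p : 'S_n, forall i, p i = #|[pred j : 'I_n | v j < v i]| :> nat.
Proof.
move=> v_inj; pose r (i : 'I_n) := #|[pred j : 'I_n | v j < v i]|.
have r_lt i : r i < n.
  rewrite -[n in _ < n]card_ord; apply: proper_card; apply/properP.
  by split; [exact/subsetP | exists i; rewrite ?inE ?ltnn].
have r_mono (i j : 'I_n) : v i < v j -> r i < r j.
  move=> ltij; apply: proper_card; apply/properP; split.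
    by apply/subsetP => k; rewrite !inE => /ltn_trans; apply.
  by exists i; rewrite ?inE ?ltnn.
have r_inj : injective (fun i => Ordinal (r_lt i)).
  move=> i j /(congr1 val)/= eq_r; apply/eqP/negPn/negP => ne.
  have : v i <> v j.
    have [ltij|ltji|/val_inj e] := ltngtP i j; last by rewrite e eqxx in ne.
      exact: v_inj.
    by apply: nesym; apply: v_inj.
  by have [/r_mono|/r_mono|//] := ltngtP (v i) (v j); rewrite eq_r ltnn.
by exists (perm r_inj) => i; rewrite permE.
Qed.

Lemma pattern_2413 p (i j k l : 'I_(plength p)) : i < j -> j < k -> k < l ->
  tagged p k < tagged p i -> tagged p i < tagged p l -> tagged p l < tagged p j ->
  pattern p2413 p.
Proof.
move=> ij jk kl ki il lj; exists (tnth [tuple i; j; k; l]); split.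
  by case=> [[|[|[|[|//]]]] ?] [[|[|[|[|//]]]] ?] //= _;
     rewrite !(tnth_nth i) /=; lia.
by case=> [[|[|[|[|//]]]] ?] [[|[|[|[|//]]]] ?];
   rewrite /= !permE !(tnth_nth ord0) !(tnth_nth i) /= !inordK //; lia.
Qed.

Lemma pattern_3142 p (i j k l : 'I_(plength p)) : i < j -> j < k -> k < l ->
  tagged p j < tagged p l -> tagged p l < tagged p i -> tagged p i < tagged p k ->
  pattern p3142 p.
Proof.
move=> ij jk kl ki il lj; exists (tnth [tuple i; j; k; l]); split.
  by case=> [[|[|[|[|//]]]] ?] [[|[|[|[|//]]]] ?] //= _;
     rewrite !(tnth_nth i) /=; lia.
by case=> [[|[|[|[|//]]]] ?] [[|[|[|[|//]]]] ?];
   rewrite /= !permE !(tnth_nth ord0) !(tnth_nth i) /= !inordK //; lia.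
Qed.

Lemma pattern4 (pi : 'S_4) p : pattern (existT _ 4 pi) p ->
  exists f : nat -> 'I_(plength p),
    (forall l m, l < m -> m < 4 -> f l < f m) /\
    forall l m : 'I_4, pi l < pi m -> tagged p (f l) < tagged p (f m).
Proof.
move=> [f [f_incr f_ord]]; exists (fun l => f (inord l)); split.
  move=> l m ltlm ltm; apply: f_incr.
  by rewrite !inordK //; apply: ltn_trans ltlm ltm.
by move=> l m; rewrite !inord_val; apply: f_ord.
Qed.

Lemma separable_of_word p :
  (forall i j k l : 'I_(plength p), i < j -> j < k -> k < l ->
     forall b, ord b (tagged p k) (tagged p i) ->
     ord b (tagged p i) (tagged p l) -> ord b (tagged p l) (tagged p j) -> False) ->
  separable p.
Proof.
move=> sp; split=> /pattern4[f [f_incr f_ord]].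
  apply: (sp (f 0) (f 1) (f 2) (f 3) _ _ _ true); rewrite ?f_incr//=.
  - have := f_ord (@inord 3 2) (@inord 3 0).
    by rewrite !permE !(tnth_nth ord0) !inordK //= ?inordK //; apply.
  - have := f_ord (@inord 3 0) (@inord 3 3).
    by rewrite !permE !(tnth_nth ord0) !inordK //= ?inordK //; apply.
  - have := f_ord (@inord 3 3) (@inord 3 1).
    by rewrite !permE !(tnth_nth ord0) !inordK //= ?inordK //; apply.
apply: (sp (f 0) (f 1) (f 2) (f 3) _ _ _ false); rewrite ?f_incr//=.
- have := f_ord (@inord 3 0) (@inord 3 2).
  by rewrite !permE !(tnth_nth ord0) !inordK //= ?inordK //; apply.
- have := f_ord (@inord 3 3) (@inord 3 0).
  by rewrite !permE !(tnth_nth ord0) !inordK //= ?inordK //; apply.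
- have := f_ord (@inord 3 1) (@inord 3 3).
  by rewrite !permE !(tnth_nth ord0) !inordK //= ?inordK //; apply.
Qed.

Lemma word_of_separable p (i j k l : 'I_(plength p)) b : separable p ->
  i < j -> j < k -> k < l -> ord b (tagged p k) (tagged p i) ->
  ord b (tagged p i) (tagged p l) -> ord b (tagged p l) (tagged p j) -> False.
Proof.
move=> [s1 s2] ij jk kl; case: b => /= ki il lj.
  exact: s1 (pattern_2413 ij jk kl ki il lj).
exact: s2 (pattern_3142 ij jk kl lj il ki).
Qed.

Section Words.

Variables (I : finType) (q0 : I).

(** The word is described by counting, in the form in which the program computes it. *)
Lemma good_permutation (a : I -> nat -> nat) n x : good a n x ->
  let v i := a q0 (x i q0) in
  exists p : permutation, [/\ plength p = n, separable p,
    word p = [seq count (fun j => v j <= v i) (iota 0 n) | i <- iota 0 n] &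
    forall q (l m : 'I_(plength p)), tagged p l < tagged p m ->
      a q (x l q) < a q (x m q)].
Proof.
move=> gx v.
have v_inj i j : i < j -> j < n -> v i <> v j by exact: good_inj gx.
have [p pE] := standardize v_inj.
have p_lt i j : p i < p j -> v i < v j.
  rewrite !pE; apply: contraTltn => le; rewrite -leqNgt.
  apply: subset_leq_card; apply/subsetP => k; rewrite !inE => lt.
  exact: leq_trans lt le.
exists (existT _ n p); split=> //.
- apply: separable_of_word => /= i j k l ij jk kl b ki il lj.
  have lift_ord r s : ord b (p r) (p s) -> ord b (v r) (v s).
    by case: (b) => /=; exact: p_lt.
  exact: (@good_sep _ _ _ _ gx q0 b i j k l ij jk kl (ltn_ord l)
    (lift_ord _ _ ki) (lift_ord _ _ il) (lift_ord _ _ lj)).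
- rewrite /word /= -val_enum_ord -map_comp; apply: eq_map => i /=.
  rewrite count_map pE -sum1_count big_enum_cond /= sum1_card.
  (* Counting the element itself turns the 0-based rank into the 1-based entry of the word. *)
  transitivity #|[predU1 i & [pred j : 'I_n | v j < v i]]|.
    by rewrite cardU1 inE ltnn.
  apply: eq_card => j; rewrite !inE [RHS](_ : _ = (v j <= v i))//.
  have [->|ne] := eqVneq j i; first by rewrite leqnn.
  rewrite /= [RHS]leq_eqVlt; case: eqP => // e; case: (ltngtP j i) => [lt|lt|/val_inj e'].
  - by case: (v_inj j i lt (ltn_ord i)).
  - by case: (v_inj i j lt (ltn_ord j)).
  - by rewrite e' eqxx in ne.
- move=> q l m /p_lt lt.
  exact: (@good_ord _ a n x true l m q0 q gx (ltn_ord l) (ltn_ord m) lt).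
Qed.

Lemma permutation_good (s : I -> permutation) p : separable p ->
  (forall q, pattern p (s q)) ->
  exists x, good (fun q => nth 0 (word (s q))) (plength p) x.
Proof.
move=> sp /fin_all_exists[f fP].
pose x l q : nat := if insub l is Some i then f q i : nat else 0.
have xE l q : forall i : 'I_(plength p), i = l :> nat -> x l q = f q i.
  move=> i <-; rewrite /x; case: insubP => [u _ e|].
    by rewrite (_ : u = i)//; apply: val_inj.
  by rewrite ltn_ord.
exists x; split=> [i q lti|i j q ltij ltj|i j ltij ltj|q b i j k l ij jk kl ll].
- by rewrite (xE _ _ (Ordinal lti))// nth_word.
- have lti := ltn_trans ltij ltj.
  rewrite (xE _ _ (Ordinal lti))// (xE _ _ (Ordinal ltj))//.
  exact: (fP q).1.
- have lti := ltn_trans ltij ltj; pose i' := Ordinal lti; pose j' := Ordinal ltj.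
  exists (tagged p i' < tagged p j') => q.
  rewrite (xE i q i')// (xE j q j')// !nth_word.
  have [lt|gt|] := ltngtP (tagged p i') (tagged p j') => /=.
  + exact: (fP q).2.
  + exact: (fP q).2.
  + by move=> /ord_inj/perm_inj/(congr1 val)/= e; move: ltij; rewrite e ltnn.
- have lk := ltn_trans kl ll; have lj := ltn_trans jk lk.
  have li := ltn_trans ij lj.
  rewrite (xE i q (Ordinal li))// (xE j q (Ordinal lj))//.
  rewrite (xE k q (Ordinal lk))// (xE l q (Ordinal ll))// !nth_word.
  (* By definition an occurrence preserves the order. It also reflects it, since distinct elements
     of [p] have distinct, hence comparable, values. *)
  have lower r t : ord b (tagged (s q) (f q r)).+1 (tagged (s q) (f q t)).+1 ->
      ord b (tagged p r) (tagged p t).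
    move=> h; have [//|] := boolP (ord b (tagged p r) (tagged p t)).
    have [e|ne] := eqVneq r t; first by move: h; rewrite e; case: (b) => /=; lia.
    move=> /ordN h'; have {}h' : ord b (tagged p t) (tagged p r).
      by apply: h' => /ord_inj/perm_inj/eqP; apply/negP.
    move: h h'; case: (b) => /= h /(fP q).2; lia.
  move=> /lower ki /lower il /lower lj'.
  exact: (word_of_separable sp _ _ _ ki il lj').
Qed.

End Words.


(** * The algorithm *)

(** A number in base [N] with the least significant digit first, used to pack a box into one array
    index. *)
Definition horner (N : nat) (s : seq nat) : nat :=
  foldr (fun c r => r * N + c) 0 s.

Lemma horner_inj N s t : size s = size t ->
  all (ltn^~ N) s -> all (ltn^~ N) t -> horner N s = horner N t -> s = t.
Proof.
elim: s t => [|c s IHs] [|c' t] //= [eq_size] /andP[ltc sN] /andP[ltc' tN] e.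
have eq_c : c = c'.
  by have /(congr1 (modn^~ N)) := e; rewrite !modnMDl !modn_small.
rewrite eq_c; congr (_ :: _); apply: IHs => //.
move: e; rewrite eq_c => /eqP; rewrite eqn_add2r eqn_pmul2r => [/eqP//|].
exact: leq_ltn_trans ltc.
Qed.

(** * Nested loops over all coordinates *)

Section Nest.

Variables (V : countType) (Q : finType) (n : V).
Implicit Types (st : state V Q) (body : stmt V Q) (J G : state V Q -> Prop).

Definition nest (xs : seq V) body : stmt V Q :=
  foldr (fun x b => For x n b) body xs.

Lemma nest_inv N xs body J :
  (forall st, J st -> var st n = N) ->
  (forall st x v, x \in xs -> v < N -> J st -> J (setv st x v)) ->
  (forall st, J st -> J (sem body st)) ->
  forall st, J st -> J (sem (nest xs body) st).
Proof.
move=> JN; elim: xs => [|x xs IHxs] Jset Jbody st Jst /=; first exact: Jbody.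
rewrite (JN _ Jst); apply: (loop_ind (I := fun=> J)) => // v st' ltv Jst'.
apply: IHxs => // [st1 y w yxs|]; first by apply: Jset; rewrite inE yxs orbT.
by apply: Jset; rewrite ?mem_head.
Qed.

(** At some moment the loop variables take the values [u]. The body then establishes [G], and
    nothing that runs afterwards destroys it; [J] is what holds throughout. *)
Lemma nest_reach N xs body J G (u : V -> nat) :
  uniq xs -> (forall x, x \in xs -> u x < N) ->
  (forall st, J st -> var st n = N) ->
  (forall st x v, x \in xs -> v < N -> J st -> J (setv st x v)) ->
  (forall st, J st -> J (sem body st)) ->
  (forall st x, J st -> x \in xs -> var (sem body st) x = var st x) ->
  (forall st x v, x \in xs -> J st -> G st -> G (setv st x v)) ->
  (forall st, J st -> G st -> G (sem body st)) ->
  (forall st, J st -> (forall x, x \in xs -> var st x = u x) ->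
    G (sem body st)) ->
  forall st, J st -> G (sem (nest xs body) st).
Proof.
elim: xs J => [|x xs IHxs] J /=; first by move=> _ _ _ _ _ _ _ _ bG st Jst; exact: bG.
case/andP=> x_xs uniq_xs uN JN Jset Jbody same_body Gset Gbody body_G st Jst.
have xs_sub y : y \in xs -> y \in x :: xs by rewrite inE orbC => ->.
have ltx : u x < N by apply: uN; rewrite mem_head.
rewrite (JN _ Jst); set f := (f in loop f).
(* The counter runs downwards, so [G] holds from the moment it has passed [u x]. *)
suff [_ h] : (fun v st => J st /\ (v <= u x -> G st)) 0 (loop f N st) by exact: h.
apply: (loop_ind (I := fun v st => J st /\ (v <= u x -> G st))).
  by split=> //; rewrite leqNgt ltx.
move=> v st' ltv [Jst' Gst']; have Jst1 : J (setv st' x v).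
  by apply: Jset; rewrite ?mem_head.
split.
  by apply: (nest_inv JN) => // st1 y w yxs; apply: Jset; apply: xs_sub.
rewrite leq_eqVlt => /orP[/eqP eq_v|ltvx].
  (* In the decisive iteration the value of [x] becomes part of the invariant of the inner loops. *)
  apply: (IHxs (fun st => J st /\ var st x = u x)) => //.
  - by move=> y /xs_sub/uN.
  - by move=> st1 [/JN].
  - move=> st1 y w yxs ltw [Jst2 e]; split; first by apply: Jset => //; exact: xs_sub.
    by rewrite /=; case: eqP => // xy; rewrite xy yxs in x_xs.
  - move=> st1 [Jst2 e]; split; first exact: Jbody.
    by rewrite same_body ?mem_head.
  - by move=> st1 y [Jst2 _] /xs_sub; apply: same_body.
  - by move=> st1 y w /xs_sub ? [? _]; apply: Gset.
  - by move=> st1 [? _]; apply: Gbody.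
  - move=> st1 [Jst2 e] eu; apply: body_G => // y.
    by rewrite inE => /predU1P[->//|/eu].
  - by split=> //=; rewrite eqxx eq_v.
suff [] : J (sem (nest xs body) (setv st' x v)) /\
  G (sem (nest xs body) (setv st' x v)) by [].
apply: (@nest_inv N xs body (fun st => J st /\ G st)) => [st1 [/JN]//|st1 y w /xs_sub yxs ltw [? ?]|st1 [? ?]|].
- by split; [exact: Jset|exact: Gset].
- by split; [exact: Jbody|exact: Gbody].
- by split=> //; apply: Gset; rewrite ?mem_head //; exact: Gst'.
Qed.

Lemma steady_nest (v : V) xs body : n = v -> v \notin xs ->
  steady v body -> steady v (nest xs body).
Proof.
move=> <-; elim: xs => //= x xs IHxs; rewrite inE negb_or eq_sym => /andP[-> vxs] sb.
by rewrite eqxx; exact: IHxs.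
Qed.

End Nest.

Section Algorithm.

Variables (I : finType) (q0 : I).

(** The ends of the current box, the coordinates of the split point, and numbered scalars. Among the
    arrays, [None] is the table and [Some q] the word of [q]. *)
Definition vars : countType := (bool * bool * I + bool * I + nat)%type.
Definition arrs : finType := option I.
Notation expr := (expr vars arrs).
Notation stmt := (stmt vars arrs).
Notation state := (state vars arrs).

Definition cv (c : bool * bool * I) : vars := inl (inl c).
Definition mv (c : bool * I) : vars := inl (inr c).
Definition vN : vars := inr 0.
Definition vn : vars := inr 1.
Definition vi : vars := inr 2.
Definition vk : vars := inr 3.
Definition vL : vars := inr 4.
Definition vs : vars := inr 5.
Definition vt : vars := inr 6.
Definition vx : vars := inr 7.
Definition vy : vars := inr 8.
Definition vc : vars := inr 9.

Notation Var := (@Var vars arrs).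
Notation Cst := (@Cst vars arrs).

(** The index contains the deletion round [i]: each round works on a fresh part of the table, still
    zero, and nothing has to be cleared. *)
Definition adr (N i : nat) (g : box I) : nat :=
  horner N (i :: [seq g c | c <- enum {: bool * bool * I}]).

Definition adrE (ge : bool * bool * I -> expr) : expr :=
  foldr (fun e r => Plus (Scale r vN) e) (Cst 0)
    (Var vi :: [seq ge c | c <- enum {: bool * bool * I}]).

Definition sumE (es : seq expr) : expr := foldr (@Plus vars arrs) (Cst 0) es.

Definition gE c : expr := Var (cv c).
Definition mE c : expr := Var (mv c).

(** With truncated subtraction, [T + (e - T)] is the maximum of [T] and [e]. *)
Definition raise (e : expr) : stmt :=
  let T := Get None (adrE gE) in Put None (adrE gE) (Plus T (Minus e T)).

Definition point_bad (q : I) : expr :=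
  let h := mE (false, q) in let s := Get (Some q) h in
  sumE [:: Minus (gE (false, false, q)) h;
           Minus (Plus h (Cst 1)) (gE (false, true, q));
           Minus (gE (true, false, q)) s;
           Minus (Plus s (Cst 1)) (gE (true, true, q));
           Minus (Cst 1) s].

Definition split_bad (c : bool * I) : expr :=
  Plus (Minus (gE (c.1, false, c.2)) (mE c)) (Minus (mE c) (gE (c.1, true, c.2))).

(* Subtraction is truncated: the sum vanishes iff all inequalities hold. *)
Definition unless_bad (es : seq expr) : stmt -> stmt :=
  If (Minus (Cst 1) (sumE es)).

Definition split_value (d : bool) : expr :=
  Plus (Get None (adrE (sub true d gE mE)))
       (Get None (adrE (sub false (~~ d) gE mE))).

(* The position components of the split point double as the position of a
   candidate one-element pattern. *)
Definition body : stmt :=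
  Seq (unless_bad [seq point_bad q | q <- enum I] (raise (Cst 1)))
      (unless_bad [seq split_bad c | c <- enum {: bool * I}]
         (Seq (raise (split_value true)) (raise (split_value false)))).

Definition coords : seq vars :=
  [seq cv c | c <- enum {: bool * bool * I}] ++ [seq mv c | c <- enum {: bool * I}].

(** The bound [vN] exceeds the length of every common pattern, so it is a sufficient number of
    rounds. *)
Definition dp : stmt := For vk vN (nest vN coords body).

Lemma eval_adrE (st : state) ge :
  eval st (adrE ge) = adr (var st vN) (var st vi) (fun c => eval st (ge c)).
Proof.
rewrite /adrE /adr /horner /=; congr (_ * _ + _).
by elim: (enum _) => //= c s ->.
Qed.

Lemma adr_ext N i g g' : g =1 g' -> adr N i g = adr N i g'.
Proof. by move=> e; rewrite /adr (eq_map e). Qed.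

Lemma adr_inj N i i' g g' : i < N -> i' < N ->
  (forall c, g c < N) -> (forall c, g' c < N) ->
  adr N i g = adr N i' g' -> i = i' /\ g =1 g'.
Proof.
move=> lti lti' ltg ltg' e.
have : i :: [seq g c | c <- enum {: bool * bool * I}] =
       i' :: [seq g' c | c <- enum {: bool * bool * I}].
  apply: horner_inj e; rewrite /= ?size_map// ?lti ?lti';
  by apply/allP => _ /mapP[c _ ->].
case=> -> /eq_in_map e'; split=> // c; apply: e'.
by rewrite mem_enum.
Qed.

Lemma eval_sumE (T : finType) (f : T -> expr) (st : state) :
  (0 < eval st (Minus (Cst 1) (sumE [seq f c | c <- enum T]))) <->
  (forall c, eval st (f c) = 0).
Proof.
have -> : 0 < eval st (Minus (Cst 1) (sumE [seq f c | c <- enum T])) =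
    all (fun c => eval st (f c) == 0) (enum T).
  rewrite /=; elim: (enum T) => //= c s <-; case: eqP => [->//|]; lia.
split=> [/allP h c|h]; first by apply/eqP/h; rewrite mem_enum.
by apply/allP => c _; apply/eqP.
Qed.

(** * Soundness of the table *)

Section Table.

(* [st0] is the state before the table of round [i] is computed. *)
Variables (N i : nat) (st0 : state).
Hypothesis ltiN : i < N.

Notation a := (fun q => arr st0 (Some q)).

Definition table (st : state) (g : box I) : nat := arr st None (adr N i g).

(** The scalar number 3 excepted in [inv_v] is [vk], the round counter. Soundness is [inv_s];
    [inv_t] protects the parts of the table that belong to other deletion rounds. *)
Record inv (st : state) : Prop := Inv {
  invN : var st vN = N;
  invi : var st vi = i;
  inv_c : forall c, var st (cv c) < N;
  inv_m : forall c, var st (mv c) < N;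
  inv_v : forall k : nat, k != 3 -> var st (inr k) = var st0 (inr k);
  inv_a : forall q j, arr st (Some q) j = arr st0 (Some q) j;
  inv_o : out st = out st0;
  inv_t : forall i' g, i' < N -> i' != i -> (forall c, g c < N) ->
    arr st None (adr N i' g) = arr st0 None (adr N i' g);
  inv_s : forall g, (forall c, g c < N) -> ach a g (table st g) }.

Definition below (st st' : state) : Prop :=
  (forall x, var st' x = var st x) /\
  (forall j, arr st None j <= arr st' None j).

Lemma ach_ext g g' n : g =1 g' -> ach a g n -> ach a g' n.
Proof.
move=> e [x [gx fx]]; exists x; split=> // l q lel ltl.
by rewrite -!e; exact: fx.
Qed.

Definition cur (st : state) : box I := fun c => var st (cv c).
Definition curm (st : state) (c : bool * I) : nat := var st (mv c).

Lemma sem_raise st e : let A := eval st (adrE gE) in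
  sem (raise e) st = seta st None A (arr st None A + (eval st e - arr st None A)).
Proof. by []. Qed.

Lemma eval_split st d : eval st (split_value d) =
  arr st None (eval st (adrE (sub true d gE mE))) +
  arr st None (eval st (adrE (sub false (~~ d) gE mE))).
Proof. by []. Qed.

Lemma raise_ok st e : inv st -> ach a (cur st) (eval st e) ->
  let st' := sem (raise e) st in
  [/\ inv st', below st st' & eval st e <= table st' (cur st)].
Proof.
move=> [iN ii ic im iv ia io it is_] ach_e.
rewrite sem_raise !eval_adrE iN ii /=; set A := adr N i _.
have eA : A = adr N i (cur st) by [].
split.
- split=> //= [i' g lti' ne ltg|g ltg].
  + case: eqP => //= eq_A; last exact: it.
    by have [e' _] := adr_inj lti' ltiN ltg ic eq_A; rewrite e' eqxx in ne.
  + rewrite /table /=; case: eqP => /= [|_]; last exact: is_.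
    move=> /(adr_inj ltiN ltiN ltg ic)[_ eq_g].
    rewrite -maxnE; apply: (@ach_ext (cur st)) => [c|]; first by rewrite eq_g.
    by rewrite eA; case: (leqP (arr st None _) (eval st e)) => _; [|exact: is_].
- by split=> // j /=; case: eqP => //= ->; rewrite leq_addr.
- by rewrite /table /= eqxx /= -maxnE leq_maxr.
Qed.

Lemma below_trans st st' st'' : below st st' -> below st' st'' -> below st st''.
Proof.
move=> [v1 t1] [v2 t2]; split=> [x|j]; first by rewrite v2 v1.
exact: leq_trans (t1 j) (t2 j).
Qed.

Lemma eval_split_value st d : inv st -> eval st (split_value d) =
  table st (sub true d (cur st) (curm st)) +
  table st (sub false (~~ d) (cur st) (curm st)).
Proof.
move=> ist; rewrite eval_split !eval_adrE (invN ist) (invi ist) /table.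
by congr (_ + _); congr (arr st None _); apply: adr_ext => -[[ax e] q];
  rewrite /sub /=; case: ifP.
Qed.

Lemma table_ext st g g' : g =1 g' -> table st g = table st g'.
Proof. by move=> e; rewrite /table (adr_ext _ _ e). Qed.

Lemma eval_below st st' d : inv st -> inv st' -> below st st' ->
  eval st (split_value d) <= eval st' (split_value d).
Proof.
move=> ist ist' [v t]; rewrite !eval_split_value//.
have eq_sub b e : sub b e (cur st) (curm st) =1 sub b e (cur st') (curm st').
  by move=> c; rewrite /sub /cur /curm !v.
by rewrite !(table_ext _ (eq_sub _ _)) leq_add // t.
Qed.

Lemma sub_lt st d e : inv st -> forall c, sub d e (cur st) (curm st) c < N.
Proof.
by move=> ist c; rewrite /sub; case: ifP => _; [apply: inv_m|apply: inv_c].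
Qed.

Lemma split_value_ok st d : inv st -> inbox (cur st) (curm st) ->
  ach a (cur st) (eval st (split_value d)).
Proof.
move=> ist bm; rewrite eval_split_value//.
by apply: (ach_add bm); apply: inv_s => //; apply: sub_lt.
Qed.

Lemma unless_bad_ok st es s : inv st ->
  let b := 0 < eval st (Minus (Cst 1) (sumE es)) in
  (b -> inv (sem s st) /\ below st (sem s st)) ->
  let st' := sem (unless_bad es s) st in
  [/\ inv st', below st st' & b -> st' = sem s st].
Proof.
move=> ist b h; rewrite /unless_bad [sem _ _]/= -/(eval st (Minus (Cst 1) (sumE es))).
by rewrite -/b; case: b h => // /(_ isT)[? ?].
Qed.

Lemma below_cur st st' : below st st' -> cur st =1 cur st'.
Proof. by move=> [v _] c; rewrite /cur v. Qed.

Lemma below_curm st st' : below st st' -> curm st =1 curm st'.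
Proof. by move=> [v _] c; rewrite /curm v. Qed.

Lemma inbox_ext g g' m m' : g =1 g' -> m =1 m' ->
  @inbox I g m -> inbox g' m'.
Proof. by move=> eg em h ax q; rewrite -!eg -em. Qed.

Lemma point_badP st : inv st ->
  0 < eval st (Minus (Cst 1) (sumE [seq point_bad q | q <- enum I])) <->
  (forall q, 0 < arr st0 (Some q) (curm st (false, q))) /\
  fits a (cur st) 0 1 (fun=> fun q => curm st (false, q)).
Proof.
move=> ist; rewrite eval_sumE; split=> [h|[pos fts] q].
  split=> [q|l q _ _]; have := h q; rewrite /= !(inv_a ist) -/(curm st (false, q)).
    by lia.
  by rewrite -!/(cur st _); lia.
have [h1 h2] := fts 0 q isT isT; have := pos q.
rewrite /= !(inv_a ist) -/(curm st (false, q)) -!/(cur st _); lia.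
Qed.

Lemma split_badP st :
  0 < eval st (Minus (Cst 1) (sumE [seq split_bad c | c <- enum {: bool * I}])) <->
  inbox (cur st) (curm st).
Proof.
rewrite eval_sumE; split=> [h ax q|h [ax q]].
  by have := h (ax, q); rewrite /= -!/(cur st _) -!/(curm st _); lia.
by have := h ax q; rewrite /= -!/(cur st _) -!/(curm st _); lia.
Qed.

Lemma body_ok st : inv st -> let st' := sem body st in
  [/\ inv st', below st st',
    (forall q, 0 < arr st0 (Some q) (curm st (false, q))) ->
      fits a (cur st) 0 1 (fun=> fun q => curm st (false, q)) ->
      0 < table st' (cur st) &
    inbox (cur st) (curm st) -> forall d,
      eval st (split_value d) <= table st' (cur st)].
Proof.
move=> ist st'.
have [ist1 b1 e1] := @unless_bad_ok st [seq point_bad q | q <- enum I]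
  (raise (Cst 1)) ist ltac:(move=> /(point_badP ist)[pos fts];
    by have [] := @raise_ok st (Cst 1) ist (ach1 (h := fun q => curm st (false, q)) pos fts)).
set st1 := sem _ st in ist1 b1 e1.
have split_ok : 0 < eval st1 (Minus (Cst 1)
      (sumE [seq split_bad c | c <- enum {: bool * I}])) ->
    let st2 := sem (Seq (raise (split_value true)) (raise (split_value false))) st1 in
    [/\ inv st2, below st1 st2 &
      forall d, eval st1 (split_value d) <= table st2 (cur st1)].
  move=> /split_badP bm.
  have [ist2 b2 t2] := raise_ok ist1 (@split_value_ok _ true ist1 bm).
  set st2 := sem _ st1 in ist2 b2 t2.
  have bm2 : inbox (cur st2) (curm st2).
    by apply: inbox_ext bm; [exact: below_cur|exact: below_curm].
  have [ist3 b3 t3] := raise_ok ist2 (@split_value_ok _ false ist2 bm2).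
  move=> st3; split=> //; first exact: below_trans b2 b3.
  case; first exact: leq_trans t2 (b3.2 _).
  (* The skew split is evaluated after the update by the direct one; meanwhile its value can only
     have grown. *)
  rewrite (table_ext _ (below_cur b2)); apply: leq_trans t3.
  exact: eval_below.
have [ist2 b2 e2] := @unless_bad_ok st1 [seq split_bad c | c <- enum {: bool * I}]
  (Seq (raise (split_value true)) (raise (split_value false))) ist1
  ltac:(by move=> /split_ok[]).
have -> : st' = sem (unless_bad [seq split_bad c | c <- enum {: bool * I}]
  (Seq (raise (split_value true)) (raise (split_value false)))) st1 by [].
split=> //.
- exact: below_trans b1 b2.
- move=> pos fts; have ok : 0 < eval st (Minus (Cst 1)
      (sumE [seq point_bad q | q <- enum I])) by apply/(point_badP ist).
  have [_ _ t1] := @raise_ok st (Cst 1) ist (ach1 (h := fun q => curm st (false, q)) pos fts).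
  by rewrite -(e1 ok) in t1; apply: leq_trans t1 (b2.2 _).
- move=> bm d.
  have ok : 0 < eval st1 (Minus (Cst 1)
      (sumE [seq split_bad c | c <- enum {: bool * I}])).
    by apply/split_badP; apply: inbox_ext bm; [exact: below_cur|exact: below_curm].
  rewrite (e2 ok); have [_ _ /(_ d) t2] := split_ok ok.
  rewrite (table_ext _ (below_cur b1)); apply: leq_trans t2.
  exact: eval_below.
Qed.

Lemma inv_setv st x v : x \in coords -> v < N -> inv st -> inv (setv st x v).
Proof.
move=> xc ltv [iN ii ic im iv ia io it is_].
by move: xc; rewrite mem_cat => /orP[] /mapP[c _ ->]; split=> //= c';
  case: eqP.
Qed.

Lemma inv_setk st v : inv st -> inv (setv st vk v).
Proof.
move=> [iN ii ic im iv ia io it is_]; split=> //= k k3.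
by rewrite -iv//; case: eqP => // -[e]; rewrite e in k3.
Qed.

Lemma nest_body_inv st : inv st -> inv (sem (nest vN coords body) st).
Proof.
apply: nest_inv => [st1 /invN->//|st1 x v xc ltv|st1 /body_ok[]//].
exact: inv_setv.
Qed.

Lemma cv_inj : injective cv.
Proof. by move=> c c' /(congr1 (fun x => if x is inl (inl y) then y else c)). Qed.

Lemma mv_inj : injective mv.
Proof. by move=> c c' /(congr1 (fun x => if x is inl (inr y) then y else c)). Qed.

Lemma coords_uniq : uniq coords.
Proof.
rewrite cat_uniq (map_inj_uniq cv_inj) (map_inj_uniq mv_inj) !enum_uniq /=.
by rewrite andbT; apply/hasPn => _ /mapP[c _ ->]; apply/mapP => -[].
Qed.

Lemma cv_coords c : cv c \in coords.
Proof. by rewrite mem_cat map_f ?mem_enum. Qed.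

Lemma mv_coords c : mv c \in coords.
Proof. by rewrite mem_cat map_f ?orbT ?mem_enum. Qed.

(** * Completeness of the table *)

Section Completeness.

Variables (n : nat) (x : nat -> I -> nat).
Hypothesis gx : good a n x.

(* After [k] rounds, all intervals of at most [k] pattern elements have been
   found. *)
Definition found (k : nat) (st : state) : Prop :=
  forall g l r, (forall c, g c < N) -> l <= r -> r <= n -> r - l <= k ->
  fits a g l r x -> r - l <= table st g.

Lemma found_below k st st' : below st st' -> found k st -> found k st'.
Proof.
move=> [_ b] fk g l r ltg lelr ler lek fg.
exact: leq_trans (fk _ _ _ ltg lelr ler lek fg) (b _).
Qed.

(** An interval of [k.+1] elements splits into two that are already found. By [nest_reach] the loops
    bring the box together with this split at some moment, and table entries never decrease. *)
Lemma found_step k st : inv st -> found k st ->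
  found k.+1 (sem (nest vN coords body) st).
Proof.
move=> ist fk g l r ltg lelr ler lek fg.
pose J st := inv st /\ found k st.
have JN st1 : J st1 -> var st1 vN = N by move=> [/invN].
have Jset st1 y v : y \in coords -> v < N -> J st1 -> J (setv st1 y v).
  by move=> yc ltv [ist1 fk1]; split=> //; apply: inv_setv.
have Jbody st1 : J st1 -> J (sem body st1).
  by move=> [ist1 fk1]; have [ist2 b2 _ _] := body_ok ist1; split=> //;
     apply: found_below fk1.
have Jst : J st by [].
have [ler1|lt1r] := leqP (r - l) k.
  have [_ h] := nest_inv JN Jset Jbody Jst.
  exact: h.
have reach_g m : (forall c, m c < N) ->
    (forall st1, inv st1 -> found k st1 -> cur st1 =1 g -> curm st1 =1 m ->
      r - l <= table (sem body st1) g) ->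
    r - l <= table (sem (nest vN coords body) st) g.
  move=> ltm h.
  pose u (y : vars) := match y with
    | inl (inl c) => g c | inl (inr c) => m c | inr _ => 0 end.
  apply: (@nest_reach _ _ _ N _ _ J (fun st1 => r - l <= table st1 g) u) => //.
  - exact: coords_uniq.
  - by move=> y; rewrite mem_cat => /orP[] /mapP[c _ ->] /=.
  - by move=> st1 y [ist1 _] _; have [_ [-> _] _ _] := body_ok ist1.
  - move=> st1 [ist1 _] h1; have [_ [_ b] _ _] := body_ok ist1.
    exact: leq_trans h1 (b _).
  - move=> st1 [ist1 fk1] e; apply: h => // c.
      by rewrite /cur e ?cv_coords.
    by rewrite /curm e ?mv_coords.
have [eq_r|ne_r] := eqVneq r l.+1.
  have ltl : l < n by lia.
  (* For one element only the position coordinates are read as the candidate; the value coordinates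
     just have to be below [N]. *)
  apply: (reach_g (fun c => if c.1 then 0 else x l c.2)).
    move=> [[] q] /=; first by lia.
    have [] := fg l q (leqnn l) ltac:(lia).
    by move=> /andP[_ lt] _; apply: ltn_trans lt (ltg _).
  move=> st1 ist1 _ eg em; have [_ _ pt _] := body_ok ist1.
  rewrite -(table_ext _ eg) eq_r subSnn; apply: pt => [q|l' q _ _].
    by rewrite em; exact: (good_pos gx).
  by rewrite !eg em; apply: fg; lia.
have [d [c [m [ltlc ltcr gm f1 f2]]]] : exists d c m, [/\ l < c, c < r, inbox g m,
    fits a (sub true d g m) l c x & fits a (sub false (~~ d) g m) c r x].
  by apply: (fits_split q0 gx fg) => //; lia.
have ltm c' : m c' < N.
  by case: c' => ax q; have /andP[_ le] := gm ax q; apply: leq_ltn_trans le (ltg _).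
apply: (reach_g m) => // st1 ist1 fk1 eg em.
have [_ _ _ sp] := body_ok ist1.
rewrite -(table_ext _ eg).
have bm : inbox (cur st1) (curm st1) by apply: inbox_ext gm => y; rewrite ?eg ?em.
apply: leq_trans (sp bm d); rewrite eval_split_value//.
have e_sub b e : sub b e (cur st1) (curm st1) =1 sub b e g m.
  by move=> y; rewrite /sub; case: ifP => _; rewrite ?em ?eg.
rewrite !(table_ext _ (e_sub _ _)).
have lt_sub b e y : sub b e g m y < N by rewrite /sub; case: ifP => _.
(* Both parts are nonempty, hence of length at most [k]. *)
have h1 := fk1 (sub true d g m) l c (lt_sub _ _) ltac:(lia) ltac:(lia) ltac:(lia) f1.
have h2 := fk1 (sub false (~~ d) g m) c r (lt_sub _ _) ltac:(lia) ltac:(lia) ltac:(lia) f2.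
lia.
Qed.

End Completeness.

Lemma dp_inv st : inv st -> inv (sem dp st).
Proof.
move=> ist; rewrite /= (invN ist).
apply: (loop_ind (I := fun=> inv)) => // v st1 _ ist1.
exact/nest_body_inv/inv_setk.
Qed.

Lemma dp_found st n x : inv st -> good a n x -> found n x N (sem dp st).
Proof.
move=> ist gx; rewrite /= (invN ist).
set f := (f in loop f N st).
suff [_ h] : inv (loop f N st) /\ found n x (N - 0) (loop f N st).
  by rewrite subn0 in h.
apply: (loop_ind (I := fun v st => inv st /\ found n x (N - v) st)).
  split=> // g l r _ _ _; rewrite subnn; lia.
move=> v st1 ltv [ist1 fst1]; split; first exact/nest_body_inv/inv_setk.
rewrite -subSS subSn//; apply: found_step => //; first exact: inv_setk.
Qed.

End Table.

(** * Optima and blanks *)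

Definition opt (a : I -> nat -> nat) (L : nat) : Prop :=
  (exists x, good a L x) /\ forall n x, good a n x -> n <= L.

Lemma good_ext (a a' : I -> nat -> nat) n x :
  (forall q l, l < n -> a' q (x l q) = a q (x l q)) -> good a n x -> good a' n x.
Proof.
move=> e [p i d s].
split=> // [l q ltl|l r ltlr ltr|q b l r k m ltlr ltrk ltkm ltm].
- by rewrite e ?p.
- by have [b h] := d l r ltlr ltr; exists b => q; rewrite !e// (ltn_trans ltlr).
- by rewrite !e ?(ltn_trans ltkm) ?(ltn_trans ltrk) ?(ltn_trans ltlr) //; [apply: s|lia..].
Qed.

(** Elements of a pattern are never blank, so filling blanks keeps every pattern. *)
Lemma good_sub (a a' : I -> nat -> nat) n x :
  (forall q j, 0 < a q j -> a' q j = a q j) -> good a n x -> good a' n x.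
Proof. by move=> e gx; apply: good_ext (gx) => q l /(good_pos gx q)/e. Qed.

Lemma opt_ext (a a' : I -> nat -> nat) L :
  (forall q j, a q j = a' q j) -> opt a L -> opt a' L.
Proof.
move=> e [[x gx] max]; split; first by exists x; apply: good_sub gx.
by move=> n y gy; apply: (max n y); apply: good_sub gy.
Qed.

(** The bound is [N.-1] because loop variables stay below [N] and must be able to take the exclusive
    upper ends of the full box. *)
Definition bounded (N : nat) (a : I -> nat -> nat) : Prop :=
  forall q j, 0 < a q j -> j < N.-1 /\ a q j < N.-1.

Definition full (N : nat) : box I := fun c => if c.1.2 then N.-1 else 0.

Lemma good_ltn N a n x : bounded N a -> 0 < N -> good a n x -> n < N.
Proof.
move=> bd N0 gx; have le l : l < n -> l <= x l q0.
  elim: l => // l IHl ltl; apply: leq_ltn_trans (IHl (ltnW ltl)) _.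
  exact: (good_incr gx).
case: n => // n in gx le *; have := le n (leqnn _).
have [+ _] := bd q0 (x n q0) (good_pos gx q0 (leqnn _)).
lia.
Qed.

Lemma fits_full N a n x : bounded N a -> good a n x -> fits a (full N) 0 n x.
Proof. by move=> bd gx l q _ /(good_pos gx q)/bd[]; rewrite /full /=. Qed.

Lemma dp_opt N i st : i < N -> var st vN = N -> var st vi = i ->
  (forall c, var st (cv c) < N) -> (forall c, var st (mv c) < N) ->
  (forall g, (forall c, g c < N) -> table N i st g = 0) ->
  bounded N (fun q => arr st (Some q)) ->
  inv N i st (sem dp st) /\
  opt (fun q => arr st (Some q)) (table N i (sem dp st) (full N)).
Proof.
move=> lti eN ei ltc ltm t0 bd.
have N0 : 0 < N by exact: leq_ltn_trans lti.
have ltf c : full N c < N by rewrite /full; case: ifP => // _; rewrite prednK.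
have ist : inv N i st st by split=> // g /t0->; exact: ach0.
have ist' := dp_inv lti ist; split=> //; split.
  by have [x [gx _]] := inv_s ist' ltf; exists x.
move=> n x gx; have := dp_found lti ist gx ltf (leq0n n) (leqnn n).
rewrite subn0; apply; last exact: fits_full.
exact: ltnW (good_ltn bd N0 gx).
Qed.

Definition fullE (c : bool * bool * I) : expr :=
  if c.1.2 then Minus (Var vN) (Cst 1) else Cst 0.

(* An element of the word [q0] is deleted for good if this does not decrease
   the optimum. *)
Definition try_delete : stmt :=
  Seq (Assign vs (Get (Some q0) (Var vi)))
 (Seq (Put (Some q0) (Var vi) (Cst 0))
 (Seq dp
 (Seq (Assign vt (Get None (adrE fullE)))
 (Seq (If (Minus (Var vL) (Var vt)) (Put (Some q0) (Var vi) (Var vs)))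
      (Assign vL (Plus (Var vL) (Minus (Var vt) (Var vL)))))))).

Definition greedy : stmt := For vi vN try_delete.

Definition delete (a : I -> nat -> nat) (k : nat) (q : I) (j : nat) : nat :=
  if (q == q0) && (j == k) then 0 else a q j.

Section Greedy.

Variables (N : nat) (s : I -> nat -> nat).
Hypothesis bd : bounded N s.

(** Rounds run downwards, so the parts of the table with index below [k] belong to the rounds still
    to come. *)
Record ready (k : nat) (st : state) : Prop := Ready {
  readyN : var st vN = N;
  ready_c : forall c, var st (cv c) < N;
  ready_m : forall c, var st (mv c) < N;
  ready_t : forall i g, i < k -> (forall c, g c < N) ->
    arr st None (adr N i g) = 0;
  ready_a : forall q j, arr st (Some q) j = s q j \/ q = q0 /\ arr st (Some q) j = 0;
  ready_o : out st = [::] }.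

Definition needed (a : I -> nat -> nat) (L k : nat) : Prop :=
  forall j x, k <= j -> j < N -> 0 < a q0 j -> good (delete a j) L x -> False.

(** Either the entry is restored or its deletion stands. In the second case [vL] may still grow,
    which happens when it has not yet reached the optimum. *)
Lemma try_delete_ok k st : k < N -> ready k.+1 st ->
  let a q := arr st (Some q) in
  let st' := sem try_delete (setv st vi k) in
  let a' q := arr st' (Some q) in
  ready k st' /\
  ((forall q j, a' q j = a q j) /\ var st' vL = var st vL /\
   (forall x, good (delete a k) (var st vL) x -> False) \/
   (forall q j, a' q j = delete a k q j) /\ var st vL <= var st' vL /\
   opt (delete a k) (var st' vL)).
Proof.
move=> ltk [eN ltc ltm t0 ra ro] a.
set st1 := seta (setv (setv st vi k) vs (arr st (Some q0) k)) (Some q0) k 0.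
have a1 q j : arr st1 (Some q) j = delete a k q j by [].
have bd1 : bounded N (fun q => arr st1 (Some q)).
  move=> q j; rewrite a1 /delete /a; case: ifP => // _.
  by have [->|[_ ->]] := ra q j; first exact: bd.
have [||||| ist opt1] := @dp_opt N k st1 ltk _ _ _ _ _ bd1.
- by [].
- by [].
- by move=> c; exact: ltc.
- by move=> c; exact: ltm.
- by move=> g ltg; exact: t0.
set st2 := sem dp st1 in ist opt1; set v := table _ _ _ _ in opt1.
have ev : eval st2 (adrE fullE) = adr N k (full N).
  rewrite eval_adrE (invN ist) (invi ist); apply: adr_ext => -[[ax e] q].
  by rewrite /fullE /full /=; case: e => //=; rewrite (invN ist) subn1.
have opt2 : opt (delete a k) v by apply: opt_ext opt1.
set st3 := setv st2 vt v.
have L2 : var st2 vL = var st vL by rewrite (inv_v ist).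
have L3 : var st3 vL = var st vL by [].
have s3 : var st3 vs = arr st (Some q0) k by rewrite /= (inv_v ist).
have i3 : var st3 vi = k by rewrite /= (invi ist).
have st'E : sem try_delete (setv st vi k) =
    let st4 := if 0 < var st3 vL - v then seta st3 (Some q0) k (arr st (Some q0) k)
               else st3 in
    setv st4 vL (var st4 vL + (var st4 vt - var st4 vL)).
  have -> : sem try_delete (setv st vi k) =
    let st4 := if 0 < var st3 vL - v then seta st3 (Some q0) (var st3 vi) (var st3 vs)
               else st3 in
    setv st4 vL (var st4 vL + (var st4 vt - var st4 vL)).
    have vE : v = arr st2 None (eval st2 (adrE fullE)) by rewrite ev.
    by rewrite /st3 vE.
  by rewrite i3 s3.
rewrite st'E; have rdy3 : forall st', (forall x, x != vt -> x != vL ->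
      var st' x = var st2 x) -> out st' = out st2 ->
    (forall j, arr st' None j = arr st2 None j) ->
    (forall q j, arr st' (Some q) j = s q j \/ q = q0 /\ arr st' (Some q) j = 0) ->
    ready k st'.
  move=> st' ev' eo' et' ea'; split=> // [|c|c|i g lti ltg|].
  - by rewrite ev'// (invN ist).
  - by rewrite ev'//; exact: (inv_c ist).
  - by rewrite ev'//; exact: (inv_m ist).
  - rewrite et' (inv_t ist)//; [|exact: ltn_trans ltk|by rewrite ltn_eqF].
    by apply: t0 => //; apply: ltnW.
  - by rewrite eo' (inv_o ist).
have a2 q j : arr st2 (Some q) j = delete a k q j by rewrite (inv_a ist).
have a_ok q j : delete a k q j = s q j \/ q = q0 /\ delete a k q j = 0.
  rewrite /delete; case: andP => [[/eqP-> _]|_]; first by right.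
  exact: ra.
rewrite subn_gt0 L3; case: ltnP => [ltv|lev] /=; rewrite L2; split.
- apply: rdy3 => //= [x /negbTE-> /negbTE->//|q j].
  have [[->]|ne] := eqVneq (Some q) (Some q0); last by rewrite /= a2.
  by have [->|nj] := eqVneq j k; [exact: ra | rewrite /= a2].
- left; split=> [q j|].
    rewrite a2 /delete; have [[->]|ne] := eqVneq (Some q) (Some q0).
      by rewrite eqxx; case: eqP => // ->.
    by rewrite (_ : q == q0 = false) //; apply/eqP => e; rewrite e eqxx in ne.
  split; first by lia.
  move=> x /(proj2 opt2); lia.
- apply: rdy3 => //= [x /negbTE-> /negbTE->//|q j].
  by rewrite a2.
- right; split=> //; split; first by lia.
  by rewrite (_ : _ + _ = v); last by lia.
Qed.

Lemma greedy_ok st : 0 < N -> ready N st -> var st vL = 0 ->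
  (forall q j, arr st (Some q) j = s q j) ->
  let st' := sem greedy st in let a q := arr st' (Some q) in
  [/\ ready 0 st', opt s (var st' vL), opt a (var st' vL) &
    needed a (var st' vL) 0].
Proof.
move=> N0 rst L0 ea st'.
pose P k st := [/\ ready k st, opt s (var st vL),
  opt (fun q => arr st (Some q)) (var st vL) &
  needed (fun q => arr st (Some q)) (var st vL) k].
rewrite /st' [sem _ _]/= (readyN rst); set f := (f in loop f N st).
have ltM : N.-1 < N by rewrite prednK.
(* The round at position [N.-1] is treated apart: that position is blank, so the round deletes
   nothing and its effect is to set [vL] to the optimum. *)
have -> : loop f N st = loop f N.-1 (f N.-1 st) by rewrite -{1}(prednK N0).
have {}rst : ready N.-1.+1 st by rewrite prednK.
suff [] : P 0 (loop f N.-1 (f N.-1 st)) by [].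
have delete_blank a k : a q0 k = 0 -> forall q j, delete a k q j = a q j.
  by move=> a0 q j; rewrite /delete; case: andP => // -[/eqP-> /eqP->].
apply: (loop_ind (I := P)) => [|k st1 ltk [rst1 optS optA need]].
  have eM q j : delete (fun q => arr st (Some q)) N.-1 q j = s q j.
    rewrite /delete -ea; case: ifP => // /andP[/eqP-> /eqP->].
    case: (posnP (arr st (Some q0) N.-1)) => [->//|s_gt0]; have [] := @bd q0 N.-1; first by rewrite -ea.
    by rewrite ltnn.
  have [rst1 [[_ [_ nope]]|[e1 [_ opt1]]]] := try_delete_ok ltM rst.
    (* As [vL] is still 0, the restoring case would deny the existence of the empty pattern. *)
    case: (nope (fun=> fun=> 0)); rewrite L0; split=> // q b i j k l *; lia.
  have optS : opt s (var (f N.-1 st) vL) by apply: opt_ext opt1.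
  split=> // [|j x leMj ltj].
    by apply: opt_ext optS => q j; rewrite e1 eM.
  have -> : j = N.-1 by lia.
  by rewrite e1 /delete !eqxx.
have {}ltk : k < N by lia.
have [rst2 [[ea2 [eL nope]]|[ea2 [leL opt2]]]] := try_delete_ok ltk rst1.
  have eL' : var (f k st1) vL = var st1 vL by [].
  split=> //; rewrite ?eL' //.
    by apply: opt_ext optA => q j; rewrite ea2.
  move=> j x; rewrite leq_eqVlt => /predU1P[<- _ _ gx|ltkj ltj aj gx].
    apply: (nope x); apply: good_sub gx => q j'; rewrite /delete -ea2.
    by case: ifP.
  apply: (need j x) => //; first by rewrite -ea2.
  by apply: good_sub gx => q j'; rewrite /delete -ea2; case: ifP.
(* Here [vL] was already optimal, and a deletion cannot increase the optimum. *)
have eL : var (f k st1) vL = var st1 vL.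
  apply/eqP; rewrite eqn_leq leL andbT; have [[x gx] _] := opt2.
  apply: (optA.2 _ x); apply: good_sub gx => q j; rewrite /delete.
  by case: ifP.
split=> //; rewrite ?eL//.
  by rewrite eL in opt2; apply: opt_ext opt2 => q j; rewrite ea2.
move=> j x; rewrite leq_eqVlt => /predU1P[<- _|ltkj ltj].
  by rewrite ea2 /delete !eqxx.
rewrite ea2 /delete eqxx /= (gtn_eqF ltkj) => aj gx.
(* A needed element remains needed after further deletions, by [good_sub]. *)
apply: (need j x) => //; apply: good_sub gx => q j'.
by rewrite /delete !ea2 /delete; case: ifP => // _; case: ifP.
Qed.

End Greedy.

(** * Output of the standardized word *)

Definition cur_pos : expr := Minus (Minus (Var vN) (Cst 1)) (Var vx).

(** The difference [e + 1 - b] is positive exactly if [b <= e]. The element itself is counted, so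
    ranks start at 1. *)
Definition count_smaller (e : expr) : stmt :=
  For vy vN (If (Get (Some q0) (Var vy))
    (If (Minus (Plus e (Cst 1)) (Get (Some q0) (Var vy)))
      (Assign vc (Plus (Var vc) (Cst 1))))).

Definition print_rank : stmt :=
  If (Get (Some q0) cur_pos)
    (Seq (Assign vc (Cst 0))
    (Seq (count_smaller (Get (Some q0) cur_pos)) (Out (Var vc)))).

(** The loop counts down, and [cur_pos] mirrors its counter, so the word is printed from left to
    right. *)
Definition print : stmt := For vx vN print_rank.

Definition rank_in (b : nat -> nat) (N x : nat) : nat :=
  count (fun y => (0 < b y) && (b y <= b x)) (iota 0 N).

Lemma count_smaller_ok st N x : var st vN = N -> var st vc = 0 ->
  N.-1 - var st vx = x ->
  let st' := sem (count_smaller (Get (Some q0) cur_pos)) st in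
  [/\ var st' vc = rank_in (arr st (Some q0)) N x, var st' vN = N,
      arr st' = arr st & out st' = out st].
Proof.
move=> eN c0 ex /=; rewrite eN; set b := arr st (Some q0).
set f := (f in loop f N st).
suff [? ? ? ? ?] : [/\ var (loop f N st) vc =
    count (fun y => (0 < b y) && (b y <= b x)) (iota 0 (N - 0)),
    var (loop f N st) vN = N, arr (loop f N st) = arr st,
    out (loop f N st) = out st & var (loop f N st) vx = var st vx].
  by split=> //; rewrite /rank_in -[N in iota 0 N]subn0.
apply: (loop_ind (I := fun k st' => [/\ var st' vc =
  count (fun y => (0 < b y) && (b y <= b x)) (iota k (N - k)),
  var st' vN = N, arr st' = arr st,
  out st' = out st & var st' vx = var st vx])).
  by split=> //; rewrite subnn.
move=> k st' ltk [ec eN' ea eo ex']; rewrite /f /= ea ex' eN' -/b subn1 ex.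
rewrite (_ : N - k = (N - k.+1).+1) /=; last by lia.
rewrite (_ : (0 < b x + 1 - b k) = (b k <= b x)); last by lia.
by case: (0 < b k); case: (b k <= b x) => /=; split=> //=; rewrite ?ec ?ea//; lia.
Qed.

Lemma sem_print_rank st : sem print_rank st =
  if 0 < arr st (Some q0) (eval st cur_pos) then
    let st' := sem (count_smaller (Get (Some q0) cur_pos)) (setv st vc 0) in
    State (var st') (arr st') (inp st') (rcons (out st') (var st' vc))
  else st.
Proof. by []. Qed.

Lemma print_ok st N : var st vN = N -> let b := arr st (Some q0) in
  out (sem print st) =
    out st ++ [seq rank_in b N x | x <- iota 0 N & 0 < b x].
Proof.
move=> eN b; pose f k st' := sem print_rank (setv st' vx k).
have -> : sem print st = loop f N st by rewrite -eN.
suff [_ _ ->] : [/\ var (loop f N st) vN = N, arr (loop f N st) = arr st &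
  out (loop f N st) = out st ++
    [seq rank_in b N x | x <- iota 0 (N - 0) & 0 < b x]] by rewrite subn0.
apply: (loop_ind (I := fun k st' => [/\ var st' vN = N, arr st' = arr st &
  out st' = out st ++ [seq rank_in b N x | x <- iota 0 (N - k) & 0 < b x]])).
  by rewrite subnn cats0.
move=> k st' ltk [eN' ea eo].
have eNk : N - k = (N - k.+1).+1 by lia.
rewrite eNk -[(N - k.+1).+1]addn1 iotaD add0n filter_cat map_cat catA -eo /=.
have epos : eval (setv st' vx k) cur_pos = N - k.+1.
  by rewrite /= eN' subn1; lia.
rewrite /f sem_print_rank epos [arr _ _]/= ea -/b.
case: ifP => [b_gt0|_] /=; last by rewrite cats0.
have [||| e1 e2 e3 e4] := @count_smaller_ok (setv (setv st' vx k) vc 0) N (N - k.+1).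
- by [].
- by [].
- by rewrite /=; lia.
set st1 := sem _ _ in e1 e2 e3 e4 *.
by split; rewrite ?e3//= e4 e1 /= ea -cats1.
Qed.

(** * Input of the words *)

Definition read_word (q : I) : stmt :=
  Seq (In _ vn) (Seq (Assign vN (Plus (Var vN) (Var vn)))
    (For vx vn (Seq (In _ vy)
      (Put (Some q) (Minus (Minus (Var vn) (Cst 1)) (Var vx)) (Var vy))))).

Definition read_vars : seq vars := [:: vn; vN; vx; vy].

Lemma read_word_ok q w r st : inp st = size w :: w ++ r ->
  let st' := sem (read_word q) st in
  [/\ inp st' = r, out st' = out st, var st' vN = var st vN + size w,
      forall x, x \notin read_vars -> var st' x = var st x &
      forall q' j, arr st' q' j =
        if (q' == Some q) && (j < size w) then nth 0 w j else arr st q' j].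
Proof.
move=> ei; rewrite /= ei /=; set n := size w; set st1 := setv _ vN _.
set f := (f in loop f n _).
suff [ei' ? ? ? [_ ea']] : [/\ inp (loop f n st1) = drop (n - 0) w ++ r,
    out (loop f n st1) = out st, var (loop f n st1) vN = var st vN + n,
    forall x, x \notin read_vars -> var (loop f n st1) x = var st x &
    var (loop f n st1) vn = n /\ forall q' j, arr (loop f n st1) q' j =
        if (q' == Some q) && (j < n - 0) then nth 0 w j else arr st q' j].
  split=> //; first by rewrite ei' subn0 drop_size.
  by move=> q' j; rewrite ea' subn0.
apply: (loop_ind (I := fun k st' => [/\ inp st' = drop (n - k) w ++ r,
    out st' = out st, var st' vN = var st vN + n,
    forall x, x \notin read_vars -> var st' x = var st x &
    var st' vn = n /\ forall q' j, arr st' q' j =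
        if (q' == Some q) && (j < n - k) then nth 0 w j else arr st q' j])).
  split=> //=; first by rewrite subnn drop0.
    move=> x; rewrite !inE !negb_or => /and4P[nx1 nx2 _ _].
    by rewrite (negbTE nx1) (negbTE nx2).
  by split=> // q' j; rewrite subnn ltn0 andbF.
move=> k st' ltk [ei' eo' eN' ev' [en' ea']].
have eNk : n - k = (n - k.+1).+1 by lia.
have ltn : n - k.+1 < size w by rewrite -/n; lia.
rewrite (drop_nth 0 ltn) -eNk /= in ei'.
rewrite /f /= ei' /=; split=> //.
  move=> x; move: (ev' x); rewrite !inE !negb_or => ev'' /and4P[nx1 nx2 nx3 nx4].
  by rewrite (negbTE nx4) (negbTE nx3) ev'' // nx1 nx2 nx3 nx4.
split=> // q' j; rewrite en' ea'.
have [->|//] := eqVneq q' (Some q); rewrite /=.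
rewrite (_ : n - 1 - k = n - k.+1); last by lia.
by rewrite eNk ltnS [j <= _]leq_eqVlt; case: eqP => [->|].
Qed.

Fixpoint reads (qs : seq I) : stmt :=
  if qs is q :: qs' then Seq (read_word q) (reads qs') else Skip _ _.

Definition instance (W : I -> seq nat) (qs : seq I) : seq nat :=
  flatten [seq size (W q) :: W q | q <- qs].

Lemma reads_ok W qs st : uniq qs -> inp st = instance W qs ->
  let st' := sem (reads qs) st in
  [/\ out st' = out st, var st' vN = var st vN + sumn [seq size (W q) | q <- qs],
      forall x, x \notin read_vars -> var st' x = var st x,
      forall j, arr st' None j = arr st None j &
      forall q j, arr st' (Some q) j =
        if (q \in qs) && (j < size (W q)) then nth 0 (W q) j else arr st (Some q) j].
Proof.
elim: qs st => [|q qs IHqs] st /=; first by rewrite addn0.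
case/andP=> nq uqs ei; have [ei1 eo1 eN1 ev1 ea1] := @read_word_ok q _ _ st ei.
set st1 := sem (read_word q) st in ei1 eo1 eN1 ev1 ea1.
rewrite -/(sem (read_word q) st) -/st1.
have [eo eN ev et ea] := IHqs st1 uqs ei1; split.
- by rewrite eo.
- by rewrite eN eN1 addnA.
- by move=> x nx; rewrite ev// ev1.
- by move=> j; rewrite et ea1.
move=> q' j; rewrite ea ea1 inE (inj_eq Some_inj).
have [->|ne] := eqVneq q' q; first by rewrite (negbTE nq).
by [].
Qed.

(** Reading changes [vN], so [steady] is applied to the loop over a single word, with [vn] as the
    controlling variable. The bound is uniform because the list of words is fixed. *)
Lemma reads_cost qs : exists a d, forall W st, inp st = instance W qs ->
  stmt_cost (reads qs) st <= a * (sumn [seq size (W q) | q <- qs]).+1 ^ d.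
Proof.
elim: qs => [|q qs [a [d H]]]; first by exists 0, 0.
have [b [e G]] : exists b e, forall st, stmt_cost (For vx vn (Seq (In _ vy)
      (Put (Some q) (Minus (Minus (Var vn) (Cst 1)) (Var vx)) (Var vy)))) st <=
    b * (var st vn).+1 ^ e by exact: steady_cost.
exists (8 + b + a), (e + d) => W st ei.
have [ei1 _ _ _ _] := @read_word_ok q _ _ st ei.
have := H W _ ei1; set S := sumn _ => h1; rewrite [sumn _]/= -/S.
have pow c k k' m m' : k <= k' -> m <= m' -> c * m.+1 ^ k <= c * m'.+1 ^ k'.
  move=> lek lem; rewrite leq_mul2l; apply/orP; right.
  apply: (@leq_trans (m'.+1 ^ k)); last by rewrite leq_pexp2l.
  by case: k {lek} => // k; rewrite leq_exp2r.
have -> : stmt_cost (reads (q :: qs)) st = 8 +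
    stmt_cost (For vx vn (Seq (In _ vy)
      (Put (Some q) (Minus (Minus (Var vn) (Cst 1)) (Var vx)) (Var vy))))
      (sem (Assign vN (Plus (Var vN) (Var vn))) (sem (In _ vn) st)) +
    stmt_cost (reads qs) (sem (read_word q) st) by [].
rewrite !mulnDl !leq_add//.
- by rewrite -[X in X <= _]muln1 leq_mul2l expn_gt0.
- by apply: leq_trans (G _) _; apply: pow; rewrite ?leq_addr //= ei /= leq_addr.
- by apply: leq_trans h1 _; apply: pow; rewrite ?leq_addl.
Qed.

(** * Cost of the algorithm *)

Lemma steady_adrE ge : (forall c, steady_expr vN (ge c)) -> steady_expr vN (adrE ge).
Proof.
by move=> h; rewrite /adrE /= !andbT; elim: (enum _) => //= c l ->; rewrite eqxx h.
Qed.

Lemma steady_sumE (T : finType) (f : T -> expr) :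
  (forall c, steady_expr vN (f c)) -> steady_expr vN (sumE [seq f c | c <- enum T]).
Proof. by move=> h; rewrite /sumE; elim: (enum T) => //= c l ->; rewrite h. Qed.

Lemma steady_raise e : steady_expr vN e -> steady vN (raise e).
Proof.
move=> se; have sA : steady_expr vN (adrE gE) by exact: steady_adrE.
change (steady_expr vN (adrE gE) && (steady_expr vN (adrE gE) &&
  (steady_expr vN e && steady_expr vN (adrE gE)))).
by rewrite sA se.
Qed.

Lemma steady_split_value d : steady_expr vN (split_value d).
Proof.
change (steady_expr vN (adrE (sub true d gE mE)) &&
  steady_expr vN (adrE (sub false (~~ d) gE mE))).
by rewrite !steady_adrE // => c; rewrite /sub; case: ifP.
Qed.

Lemma steady_unless_bad (T : finType) (f : T -> expr) t :
  (forall c, steady_expr vN (f c)) -> steady vN t ->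
  steady vN (unless_bad [seq f c | c <- enum T] t).
Proof. by move=> sf st; rewrite /= st andbT; exact: steady_sumE. Qed.

Lemma steady_body : steady vN body.
Proof.
have h1 := @steady_unless_bad I point_bad _ ltac:(by []) (steady_raise (e := Cst 1) isT).
have h2 : steady vN (Seq (raise (split_value true)) (raise (split_value false))).
  exact (introT andP (conj (steady_raise (steady_split_value true))
                           (steady_raise (steady_split_value false)))).
have h3 := @steady_unless_bad _ split_bad _ ltac:(by []) h2.
exact (introT andP (conj h1 h3)).
Qed.

Lemma steady_dp : steady vN dp.
Proof.
apply/and3P; split=> //; apply: steady_nest steady_body => //.
by rewrite mem_cat negb_or; apply/andP; split; apply/mapP => -[].
Qed.

Lemma steady_greedy : steady vN greedy.
Proof.
have sF : steady_expr vN (adrE fullE).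
  by apply: (@steady_adrE fullE) => -[[ax []] q].
change (true && (true && (true && (true && (steady vN dp &&
  (true && steady_expr vN (adrE fullE) && (true && true))))))).
by rewrite sF steady_dp.
Qed.

(** Values reach at most the total length of the words. Starting [vN] at 2 makes [vN - 1] exceed
    them, as [bounded] demands. *)
Definition algorithm : stmt :=
  Seq (Seq (Assign vN (Cst 2)) (reads (enum I))) (Seq greedy print).

(** After the input phase [vN] is the total length plus 2, and [steady_cost] bounds by powers of its
    successor: hence the [.+3]. *)
Lemma algorithm_cost : exists a d, forall W : I -> seq nat,
  stmt_cost algorithm (init_state vars arrs (instance W (enum I))) <=
  a * (sumn [seq size (W q) | q <- enum I]).+3 ^ d.
Proof.
have [a [d H]] := reads_cost (enum I).
have [b [e G]] := @steady_cost _ _ vN (Seq greedy print)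
  (introT andP (conj steady_greedy isT)).
exists (3 + a + b), (d + e) => W; set S := sumn _.
set st0 := setv (init_state vars arrs (instance W (enum I))) vN 2.
have [_ eN _ _ _] := @reads_ok W (enum I) st0 (enum_uniq _) erefl.
have := H W st0 erefl; have := G (sem (reads (enum I)) st0).
rewrite eN add2n -/S => g h.
have -> : stmt_cost algorithm (init_state vars arrs (instance W (enum I))) =
  3 + stmt_cost (reads (enum I)) st0 +
  stmt_cost (Seq greedy print) (sem (reads (enum I)) st0) by [].
rewrite !mulnDl !leq_add//.
- by rewrite -[X in X <= _]muln1 leq_mul2l expn_gt0.
- apply: leq_trans h _; rewrite leq_mul2l; apply/orP; right.
  apply: (@leq_trans (S.+3 ^ d)); last by rewrite leq_pexp2l ?leq_addr.
  by case: (d) => // k; rewrite leq_exp2r//; lia.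
- apply: leq_trans g _; rewrite leq_mul2l; apply/orP; right.
  by rewrite leq_pexp2l ?leq_addl.
Qed.

(** * Correctness of the output *)

Section Correctness.

Variable s : I -> permutation.

Notation W := (fun q => word (s q)).
Notation S := (sumn [seq size (W q) | q <- enum I]).

Lemma size_W q : size (W q) <= S.
Proof.
rewrite sumnE big_map big_enum /= (bigD1 q)//=; exact: leq_addr.
Qed.

Lemma W_bounded : bounded S.+2 (fun q => nth 0 (W q)).
Proof.
move=> q j /nth_word_gt0 ltj; have := size_W q; rewrite size_word => leS.
split; first exact: leq_trans (leq_trans ltj leS) _.
by rewrite (nth_word (Ordinal ltj)) /= ltnS; apply: leq_trans leS.
Qed.

Lemma algorithm_ok :
  exists p, [/\ out (sem algorithm (init_state vars arrs (instance W (enum I)))) = word p,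
    separable p, forall q, pattern p (s q) &
    forall p', separable p' -> (forall q, pattern p' (s q)) ->
      plength p' <= plength p].
Proof.
set st0 := setv (init_state vars arrs (instance W (enum I))) vN 2.
have [eo eN ev et ea] := @reads_ok W (enum I) st0 (enum_uniq _) erefl.
set st1 := sem _ st0 in eo eN ev et ea.
set N := S.+2; have eN1 : var st1 vN = N by rewrite eN /= add2n.
have ea1 q j : arr st1 (Some q) j = nth 0 (W q) j.
  rewrite ea mem_enum /=; case: ltnP => // lej.
  by rewrite nth_default.
have rst1 : ready N (fun q => nth 0 (W q)) N st1.
  by split=> // [c|c|q j]; rewrite ?ev//; left.
have [rst2 opts opta need] := greedy_ok W_bounded isT rst1 ltac:(by rewrite ev) ea1.
set st2 := sem greedy st1 in rst2 opts opta need.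
pose a q := arr st2 (Some q); rewrite -/a in opta need.
set L := var st2 vL in opts opta need.
have as_ q j : 0 < a q j -> nth 0 (W q) j = a q j.
  by rewrite /a; case: (ready_a rst2 q j) => [->//|[_ ->]].
have bda : bounded N a by move=> q j aj; rewrite -(as_ q j aj); apply: W_bounded; rewrite as_.
have [[x gx] _] := opta; have gsx := good_sub as_ gx.
have [p [szp sp wp vp]] := good_permutation q0 gx.
exists p; split=> //.
- have -> : sem algorithm (init_state vars arrs (instance W (enum I))) = sem print st2 by [].
  have -> : out (sem print st2) = [seq rank_in (a q0) N i | i <- iota 0 N & 0 < a q0 i].
    by rewrite (print_ok (readyN rst2)) (ready_o rst2).
  (* Both lists are increasing. Positions of [x] carry nonzero entries; conversely, an entry outside
     [x] could be deleted without harm to [x], against [need]. *)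
  have kept : [seq i <- iota 0 N | 0 < a q0 i] = [seq x l q0 | l <- iota 0 L].
    apply: (irr_sorted_eq ltn_trans ltnn).
    - by apply: sorted_filter (iota_ltn_sorted _ _); exact: ltn_trans.
    - rewrite sorted_map; apply: (@sub_in_sorted _ (mem (iota 0 L)) ltn) (iota_ltn_sorted 0 L).
        move=> l r; rewrite !mem_iota /= => _ ltr ltlr; exact: (good_incr gx).
      exact/allP.
    move=> i; rewrite mem_filter mem_iota /= add0n.
    apply/andP/mapP => [[ai lti]|[l]].
      have [/mapP//|ni] := boolP (i \in [seq x l q0 | l <- iota 0 L]).
      case: (need i x _ lti ai) => //; apply: good_ext gx => q l ltl.
      rewrite /delete; case: andP => // -[/eqP-> /eqP eq_i]; case/negP: ni.
      by apply/mapP; exists l; rewrite ?mem_iota.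
    rewrite mem_iota /= => ltl ->; have xl := good_pos gx q0 ltl.
    by split=> //; have [+ _] := bda _ _ xl; rewrite /N /=; lia.
  rewrite kept wp -map_comp; apply: eq_map => l /=.
  rewrite -(count_map (fun j => x j q0) (fun y => a q0 y <= a q0 (x l q0))).
  by rewrite -kept count_filter; apply: eq_count => y /=; rewrite andbC.
- move=> q; have ltx (l : 'I_(plength p)) : x l q < plength (s q).
    by apply: nth_word_gt0; apply: (good_pos gsx); rewrite -szp.
  exists (fun l => Ordinal (ltx l)); split=> [l m ltlm|l m ltlm].
    by apply: (good_incr gx) => //; rewrite -szp.
  have xE (k : 'I_(plength p)) : a q (x k q) = (tagged (s q) (Ordinal (ltx k))).+1.
    rewrite -(nth_word (Ordinal (ltx k))) /=; apply/esym/as_.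
    by apply: (good_pos gx); rewrite -szp.
  by have := vp q l m ltlm; rewrite !xE.
- move=> p' sp' pp'; have [x' gx'] := permutation_good sp' pp'.
  by rewrite szp; exact: opts.2 gx'.
Qed.

End Correctness.

End Algorithm.

Lemma size_instance (I : finType) (W : I -> seq nat) qs :
  size (instance W qs) = size qs + sumn [seq size (W q) | q <- qs].
Proof.
by elim: qs => //= q qs IHqs; rewrite /instance /= size_cat -/(instance W qs) IHqs; lia.
Qed.

Lemma encode_instance K (sigma : K.-tuple permutation) :
  encode sigma = instance (fun q => word (tnth sigma q)) (enum 'I_K).
Proof.
rewrite /encode -[in LHS](map_tnth_enum sigma) -map_comp.
by congr flatten; apply: eq_map => q /=; rewrite size_word.
Qed.

Theorem theorem1 (K : nat) (hK : 1 <= K) :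
  poly_time_solvable (@encode K)
    (fun sigma y => exists p : permutation,
       y = word p /\ longest_common_separable sigma p).
Proof.
(* Since [K] is positive there is a word to delete from. *)
pose q0 := Ordinal hK; have [a [d H]] := algorithm_cost q0.
(* The input size is [K] plus the total length [S] of the words, so [S.+3] is at most 4 times it;
   this gives the factor [4 ^ d]. *)
exists (stmt_code (algorithm q0) 0 0), (a * 4 ^ d), d => sigma.
have [t let_ halt] := stmt_code_halts (algorithm q0) (encode sigma).
have [p [outp sp pp maxp]] := algorithm_ok q0 (tnth sigma).
rewrite -encode_instance in outp; rewrite outp in halt.
exists t, (word p); split=> //; last first.
  by exists p; do !split=> //; move=> p' [sp' pp']; exact: maxp.
apply: leq_trans let_ _; rewrite encode_instance; apply: leq_trans (H _) _.
apply: leq_trans (leq_addr _ _); rewrite -mulnA -expnMn leq_mul2l.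
apply/orP; right; case: (d) => // k; rewrite leq_exp2r// size_instance size_enum_ord.
by move: (sumn _) => S; lia.
Qed.
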